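(* Let $\mathcal{H}$ be a complex, separable, infinite-dimensional Hilbert space and let $\mathcal{D}=\{z\in\mathbf{C} : |z|<1\}$. Let $A$ be a bounded linear operator on $\mathcal{H}$ with $W_e(A)\supset\mathcal{D}$, and let $\{A_n\}_{n=1}^{\infty}$ be a sequence of bounded linear operators on $\mathcal{H}$ such that $\sup_n\Vert A_n\Vert<1$. Then there is a pinching $$\mathcal{P}(A)=\bigoplus_{n=1}^{\infty}A_n,$$ that is, there is a total sequence $\{E_n\}_{n=1}^{\infty}$ of nonzero mutually orthogonal projections on $\mathcal{H}$ such that, for every $n$, the compression $A_{E_n}$ is unitarily equivalent to $A_n$. Moreover, if $A$ and all the $A_n$ are real, then the pinching may be taken real, i.e. the projections $E_n$ may be taken to be real.
   Context: Inner products are linear in the second variable. A projection means an orthogonal projection, and it is identified with its range. For an operator $A$ and a projection $F$, the compression $A_F$ is the restriction of $FAF$ to the subspace $F$, regarded as an operator on $F$. A sequence $\{E_n\}$ of mutually orthogonal projections is total if $\sum_n E_n=I$ (strongly). For such a sequence of nonzero projections the associated pinching is $\mathcal{P}(A)=\sum_{n=1}^\infty E_nAE_n=\bigoplus_{n=1}^\infty A_{E_n}$; one writes $\mathcal{P}(A)=\bigoplus_n A_n$ when $A_n$ is unitarily equivalent to $A_{E_n}$ for all $n$. The essential numerical range of $A$ is $$W_e(A)=\{\lambda\in\mathbf{C} : \text{there is an orthonormal sequence } \{e_n\}_{n=1}^\infty \text{ in } \mathcal{H} \text{ with } \lim_{n\to\infty}\langle e_n,Ae_n\rangle=\lambda\}.$$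 Equivalently, $W_e(A)=\bigcap_K \overline{W}(A+K)$, where $K$ runs over all compact operators and $\overline{W}$ denotes the closure of the numerical range $W(A)=\{\langle h,Ah\rangle : \Vert h\Vert=1\}$. A real operator is an operator acting on a real Hilbert space. For the last assertion, $\mathcal{H}$ is viewed as the complexification of a real Hilbert space $\mathcal{H}_{\mathbf{R}}$; an operator or a projection on $\mathcal{H}$ is real if it is the complexification of an operator or a projection on $\mathcal{H}_{\mathbf{R}}$, and $W_e(A)$ is computed on the complex space $\mathcal{H}$. *)

(* Defs.v *)
From HB Require Import structures.
From mathcomp Require Import all_boot all_order all_algebra.
From mathcomp Require Import sesquilinear complex.
From mathcomp Require Import all_classical all_reals all_analysis.

Set Implicit Arguments.
Unset Strict Implicit.
Unset Printing Implicit Defensive.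

Import Order.TTheory GRing.Theory Num.Theory.
Import numFieldNormedType.Exports.

Local Open Scope classical_set_scope.
Local Open Scope ring_scope.
Local Open Scope complex_scope.

(* A Hilbert space is a complete normed module with a positive definite
   Hermitian form [dot] inducing the norm; [theta] is complex conjugation over
   R[i] and the identity over R. *)

Section Hilbert.
Context {K : numFieldType} {theta : K -> K} {V : completeNormedModType K}.
Variable dot : {dot V for theta}.

Definition induces_norm : Prop := forall x : V, dot x x = `|x| ^+ 2.

(* The library's forms are linear in the first variable; [inner] is linear in
   the second one. *)
Definition inner (x y : V) : K := dot y x.

Definition bounded_operator (T : {linear V -> V}) : Prop :=
  bounded_near T (nbhs (0 : V)).

Definition is_projection (E : {linear V -> V}) : Prop :=
  [/\ bounded_operator E, forall x, E (E x) = E x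
    & forall x y, inner (E x) y = inner x (E y)].

Definition orthonormal_seq (e : nat -> V) : Prop :=
  forall m n, inner (e m) (e n) = (m == n)%:R.

Definition ess_num_range (T : {linear V -> V}) : set K :=
  [set l | exists2 e : nat -> V, orthonormal_seq e &
     (fun n => inner (e n) (T (e n))) @ \oo --> l].

Definition total_projections (E : nat -> {linear V -> V}) : Prop :=
  [/\ forall n, is_projection (E n),
      forall n, exists x, E n x != 0,
      forall m n, m != n -> forall x, E m (E n x) = 0
    & forall x : V, series (fun n => E n x) @ \oo --> x].

(* Only the values on [range F] matter: they are the compression of A to the
   subspace [range F]. *)
Definition compression (A F : {linear V -> V}) (x : V) : V := F (A (F x)).

(* U is a unitary from the whole space onto the subspace range F that
   intertwines B with the compression of A to that subspace. *)
Definition compression_unitarily_equivalent (A F B : {linear V -> V}) : Prop :=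
  exists U : {linear V -> V},
    [/\ forall x y, inner (U x) (U y) = inner x y, range U = range F
      & forall x, compression A F (U x) = U (B x)].

Definition separable_space : Prop := exists2 D : set V, countable D & dense D.

Definition infinite_dimensional : Prop :=
  forall n (v : 'I_n -> V), exists x : V,
    forall c : 'I_n -> K, x <> \sum_(i < n) c i *: v i.

End Hilbert.

Arguments separable_space {K} V.
Arguments infinite_dimensional {K} V.

(* The norm of a normed module over R[i] takes its values in R[i], whence the
   real part.  The supremum is taken in the extended reals, since a supremum
   in R of an unbounded set would be 0. *)
Definition opnorm {R : realType} {H : completeNormedModType R[i]}
    (T : {linear H -> H}) : \bar R :=
  ereal_sup [set (complex.Re `|T x|)%:E | x in [set x : H | `|x| <= 1]].

Section Complexification.
Context {R : realType} {H : completeNormedModType R[i]}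
  {HR : completeNormedModType R}.

(* [iota] identifies H with the complexification HR + i HR of the real Hilbert
   space HR; uniqueness of the decomposition follows from the preservation of
   inner products. *)
Definition is_complexification (dot : {dot H for @Num.conj R[i]})
    (dotR : {dot HR for idfun}) (iota : HR -> H) : Prop :=
  [/\ forall (a : R) (x y : HR), iota (a *: x + y) = a%:C *: iota x + iota y,
      forall x y : HR, inner dot (iota x) (iota y) = (inner dotR x y)%:C
    & forall h : H, exists x y : HR, h = iota x + 'i *: iota y].

Definition complexifies (iota : HR -> H) (TR : {linear HR -> HR})
    (T : {linear H -> H}) : Prop :=
  forall x y : HR, T (iota x + 'i *: iota y) = iota (TR x) + 'i *: iota (TR y).

Definition real_operator (iota : HR -> H) (T : {linear H -> H}) : Prop :=
  exists2 TR : {linear HR -> HR}, bounded_operator TR & complexifies iota TR T.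

Definition real_projection (dotR : {dot HR for idfun}) (iota : HR -> H)
    (E : {linear H -> H}) : Prop :=
  exists2 ER : {linear HR -> HR}, is_projection dotR ER & complexifies iota ER E.

End Complexification.

(* Main.v *)
Require Import Defs.
From HB Require Import structures.
From mathcomp Require Import all_boot all_order all_algebra.
From mathcomp Require Import sesquilinear complex.
From mathcomp Require Import ring.
From mathcomp Require Import all_classical all_reals all_analysis.

Set Implicit Arguments.
Unset Strict Implicit.
Unset Printing Implicit Defensive.

Import Order.TTheory GRing.Theory Num.Theory.
Import numFieldNormedType.Exports.

Local Open Scope classical_set_scope.
Local Open Scope ring_scope.
Local Open Scope complex_scope.

(** Since W_e(A) contains the open disc, every l with |l| < 1 is exactly a value
    <z, A z> at unit vectors z orthogonal to any prescribed finite set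
    (persistent_value): approximate values come from combinations of far terms
    of an orthonormal sequence, and convexity makes them exact.  Taking the
    values r w^k for w a primitive root of unity and applying the discrete
    Fourier transform yields blocks e_0, ..., e_m on which A compresses to r
    times the nilpotent shift, again orthogonal to any prescribed finite set
    (shift_blocks_of_values).

    Infinitely many such blocks carry every operator X with
    |X| <= r m/(m+1): a contraction Y is, up to the factor m/(m+1), a
    compression of a multiple of the nilpotent shift of size m+1
    (contraction_dilation).  As sup |A_n| < 1, a single choice of r and m
    serves all the A_n.

    To make the pinching total, one step starts from a vector h of the space
    that is still free and makes the range of the new projection lean towards h,
    by an amount that depends only on |A| and sup |A_n|; blocks kept in
    reserve leave the complement as rich as before
    (compression_through_vector).  Treating the vectors of a dense sequence
    infinitely often exhausts the space (pinching_of_shift_blocks).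

    These last two stages use nothing of the scalars but conj_scalars, so they
    run over R as well.  For the real assertion they are applied in the real
    space, where the blocks are 2^(1/2) Re f for complex blocks f orthogonal
    and A-orthogonal to their conjugates; this position is reached because
    three vectors always admit a combination isotropic for two quadratic forms
    without cross terms (isotropic_value, real_shift_blocks).  The projections
    found there are then complexified. *)

(** * Scalars and semi-inner products *)

(** What the construction uses of R with the identity and of C with
    conjugation.  Completeness enters as the Cauchy property of decreasing
    nonnegative sequences, which makes sense for the partial order of C. *)
Record conj_scalars (K : numFieldType) (theta : K -> K) : Prop := ConjScalars {
  conj_mul : forall a : K, theta a * a = `|a| ^+ 2;
  root_exists : forall a : K, 0 <= a -> exists2 s : K, 0 <= s & s ^+ 2 = a;
  decreasing_cauchy : forall u : nat -> K, (forall n, 0 <= u n.+1 <= u n) ->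
    forall e, 0 < e -> exists n, forall m, (n <= m)%N -> u n - u m < e }.

Section SemiInner.
Context {K : numFieldType} {theta : {rmorphism K -> K}} {V : lmodType K}.
Hypothesis Kok : conj_scalars theta.

Record semi_inner (b : V -> V -> K) : Prop := SemiInner {
  formP : forall x a y z, b x (a *: y + z) = a * b x y + b x z;
  formC : forall x y, theta (b x y) = b y x;
  form_ge0 : forall x, 0 <= b x x }.

Lemma conj_ge0 a : 0 <= a -> theta a = a.
Proof.
move=> a0; have [->|aN0] := eqVneq a 0; first by rewrite rmorph0.
apply: (mulIf aN0); rewrite (conj_mul Kok).
by rewrite ger0_norm // expr2.
Qed.

Variable b : V -> V -> K.
Hypothesis bP : semi_inner b.

Lemma formDr x y z : b x (y + z) = b x y + b x z.
Proof. by have := formP bP x 1 y z; rewrite scale1r mul1r. Qed.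

Lemma form0r x : b x 0 = 0.
Proof. by apply: (addrI (b x 0)); rewrite -formDr !addr0. Qed.

Lemma formZr x a y : b x (a *: y) = a * b x y.
Proof. by have := formP bP x a y 0; rewrite !addr0 form0r addr0. Qed.

Lemma formNr x y : b x (- y) = - b x y.
Proof. by rewrite -scaleN1r formZr mulN1r. Qed.

Lemma formBr x y z : b x (y - z) = b x y - b x z.
Proof. by rewrite formDr formNr. Qed.

Lemma form_sumr I (r : seq I) (P : pred I) (F : I -> V) x :
  b x (\sum_(i <- r | P i) F i) = \sum_(i <- r | P i) b x (F i).
Proof. exact: (big_morph (b x) (formDr x) (form0r x)). Qed.

Lemma formDl x y z : b (x + y) z = b x z + b y z.
Proof. by rewrite -!(formC bP z) formDr rmorphD. Qed.

Lemma form0l x : b 0 x = 0.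
Proof. by rewrite -(formC bP x) form0r rmorph0. Qed.

Lemma formZl x a y : b (a *: x) y = theta a * b x y.
Proof. by rewrite -!(formC bP y) formZr rmorphM. Qed.

Lemma formNl x y : b (- x) y = - b x y.
Proof. by rewrite -!(formC bP y) formNr rmorphN. Qed.

Lemma formBl x y z : b (x - y) z = b x z - b y z.
Proof. by rewrite formDl formNl. Qed.

Lemma form_suml I (r : seq I) (P : pred I) (F : I -> V) x :
  b (\sum_(i <- r | P i) F i) x = \sum_(i <- r | P i) b (F i) x.
Proof. by rewrite -(formC bP x) form_sumr rmorph_sum; apply: eq_bigr => i _; rewrite (formC bP). Qed.

Lemma form_sqr x y : b x y * b y x = `|b x y| ^+ 2.
Proof. by rewrite -(formC bP x y) mulrC (conj_mul Kok). Qed.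

Lemma formZZ a x : b (a *: x) (a *: x) = `|a| ^+ 2 * b x x.
Proof. by rewrite formZl formZr mulrA (conj_mul Kok). Qed.

Lemma pythagoras x y : b x y = 0 -> b (x + y) (x + y) = b x x + b y y.
Proof.
by move=> xy; rewrite formDl !formDr xy -(formC bP x y) xy rmorph0 addr0 add0r.
Qed.

(** Expanding b (y - t <x,y> x) for t >= 0; when b x x = 0 a large t forces
    <x,y> = 0, and otherwise t = 1 / b x x. *)
Lemma cauchy_schwarz x y : `|b x y| ^+ 2 <= b x x * b y y.
Proof.
have key t : 0 <= t -> 0 <= b y y - 2 * t * `|b x y| ^+ 2 + t ^+ 2 * `|b x y| ^+ 2 * b x x.
  move=> t0; have := form_ge0 bP (y - (t * b x y) *: x).
  rewrite formBl !formBr !formZl !formZr rmorphM (formC bP) (conj_ge0 t0).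
  rewrite -(form_sqr x y) => /le_trans; apply.
  rewrite le_eqVlt; apply/orP; left; apply/eqP.
  by rewrite expr2 -[2]/(1+1) !mulrDl !mul1r; ring.
have x0 := form_ge0 bP x; have [bx0|bxN0] := eqVneq (b x x) 0.
  have [->|c0] := eqVneq (b x y) 0; first by rewrite normr0 expr0n mulr_ge0 ?(form_ge0 bP).
  have c2 : 0 < `|b x y| ^+ 2 by rewrite exprn_gt0 ?normr_gt0.
  have y1 : 0 <= b y y + 1 by rewrite addr_ge0 ?(form_ge0 bP).
  have /key : 0 <= (b y y + 1) / `|b x y| ^+ 2 by rewrite divr_ge0 // ltW.
  suff -> : b y y - 2 * ((b y y + 1) / `|b x y| ^+ 2) * `|b x y| ^+ 2 +
      ((b y y + 1) / `|b x y| ^+ 2) ^+ 2 * `|b x y| ^+ 2 * b x x = - (b y y + 2).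
    by rewrite oppr_ge0 lt_geF // ltr_wpDl ?(form_ge0 bP) ?ltr0Sn.
  by rewrite bx0; field; rewrite normr_eq0.
have xgt : 0 < b x x by rewrite lt_def bxN0.
rewrite -subr_ge0.
have /key/(mulr_ge0 x0)/le_trans : 0 <= (b x x)^-1 by rewrite invr_ge0.
apply.
rewrite le_eqVlt; apply/orP; left; apply/eqP.
by field.
Qed.

Lemma form_null x y : b x x = 0 -> b x y = 0.
Proof.
move=> x0; have := cauchy_schwarz x y; rewrite x0 mul0r => h.
by apply/eqP; rewrite -normr_eq0 -sqrf_eq0 eq_le h exprn_ge0.
Qed.

End SemiInner.

(** * Sequences in a Hilbert space *)

Lemma cvg_ext {T : topologicalType} (u v : nat -> T) (l : T) :
  u =1 v -> u @ \oo --> l -> v @ \oo --> l.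
Proof. by move=> /funext ->. Qed.

Lemma cvg_eq {K : numFieldType} (u v : nat -> K) (a b : K) :
  u =1 v -> u @ \oo --> a -> v @ \oo --> b -> a = b.
Proof.
by move=> /funext -> ua ub; exact: (@cvg_unique _ (@norm_hausdorff K K^o) _ _ _ _ ua ub).
Qed.

Lemma cvg_dominated {K : numFieldType} {V : pseudoMetricNormedZmodType K}
    (u : nat -> V) (l : V) (c : nat -> K) :
  (forall n, `|u n - l| <= c n) -> c @ \oo --> (0 : K) -> u @ \oo --> l.
Proof.
move=> uc c0; apply/cvgrPdist_lt => e e0.
move/cvgrPdist_lt/(_ _ e0): c0; apply: filterS => n.
rewrite sub0r normrN distrC; apply: le_lt_trans; apply: le_trans (uc n) _.
by rewrite real_ler_norm // ger0_real // (le_trans _ (uc n)).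
Qed.

Lemma cvg_of_sqr_norm {K : numFieldType} {V : normedModType K} (u : nat -> V) (l : V) :
  (fun n => `|u n - l| ^+ 2) @ \oo --> (0 : K) -> u @ \oo --> l.
Proof.
move=> u0; apply/cvgrPdist_lt => e e0.
have e2 : 0 < e ^+ 2 by rewrite exprn_gt0.
move/cvgrPdist_lt/(_ _ e2): u0; apply: filterS => n.
rewrite sub0r normrN distrC normrX normr_id => h.
by rewrite -(ltr_pXn2r (n := 2)) ?nnegrE ?(ltW e0).
Qed.

Lemma cvg_sum_fin {K : numFieldType} {V : normedModType K} (I : Type) (r : seq I)
    (P : pred I) (F : I -> nat -> V) (l : I -> V) :
  (forall i, P i -> F i @ \oo --> l i) ->
  (fun n => \sum_(i <- r | P i) F i n) @ \oo --> \sum_(i <- r | P i) l i.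
Proof.
move=> Fl; elim: r => [|i r IH].
  by under eq_fun do rewrite big_nil; rewrite big_nil; exact: cvg_cst.
under eq_fun do rewrite big_cons; rewrite big_cons.
by case: ifP => // Pi; apply: cvgD => //; exact: Fl.
Qed.

Lemma linear_map_exists {K : numFieldType} {V W : normedModType K} (f : V -> W) :
  (forall a x y, f (a *: x + y) = a *: f x + f y) ->
  exists T : {linear V -> W}, forall x, T x = f x.
Proof.
move=> fP; pose g := f.
pose lin := GRing.isLinear.Build K V W *:%R g fP.
pose T : {linear V -> W} := HB.pack g lin.
by exists T.
Qed.

Section Sequences.
Context {K : numFieldType} {theta : {rmorphism K -> K}}
  {V : completeNormedModType K} {dot : {dot V for theta}}.
Hypotheses (Kok : conj_scalars theta) (dotE : induces_norm dot).
Local Notation ip := (inner dot).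

Lemma ip_semi : semi_inner (theta := theta) ip.
Proof.
rewrite /inner; split.
- by move=> x a y z; rewrite linearPl.
- by move=> x y; rewrite [RHS]hermC expr0 mul1r.
- by move=> x; rewrite dotE exprn_ge0.
Qed.

Lemma ipE x : ip x x = `|x| ^+ 2. Proof. exact: dotE. Qed.

Lemma ip_le x y : `|ip x y| <= `|x| * `|y|.
Proof.
rewrite -(ler_pXn2r (n := 2)) ?nnegrE ?mulr_ge0 // exprMn -!ipE.
exact: (cauchy_schwarz Kok ip_semi).
Qed.

Lemma ip_ext x y : (forall z, ip z x = ip z y) -> x = y.
Proof.
move=> h; apply/eqP; rewrite -subr_eq0 -normr_eq0 -sqrf_eq0 -ipE.
by rewrite (formBr ip_semi) h subrr.
Qed.

Lemma cvg_ip (u v : nat -> V) x y : u @ \oo --> x -> v @ \oo --> y ->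
  (fun n => ip (u n) (v n)) @ \oo --> ip x y.
Proof.
move=> ux vy.
apply: (@cvg_dominated _ _ _ _ (fun n => `|u n - x| * `|v n| + `|x| * `|v n - y|)).
  move=> n; rewrite (_ : _ - _ = ip (u n - x) (v n) + ip x (v n - y)).
    by rewrite (le_trans (ler_normD _ _)) // lerD // ip_le.
  by rewrite (formBl ip_semi) (formBr ip_semi) addrA subrK.
have ux0 : `|u n - x| @[n --> \oo] --> (0 : K).
  by rewrite -(normr0 V); apply: cvg_norm; rewrite -(subrr x); apply: cvgB => //; exact: cvg_cst.
have vy0 : `|v n - y| @[n --> \oo] --> (0 : K).
  by rewrite -(normr0 V); apply: cvg_norm; rewrite -(subrr y); apply: cvgB => //; exact: cvg_cst.
have vn : `|v n| @[n --> \oo] --> `|y| by apply: cvg_norm.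
rewrite (_ : 0 = 0 * `|y| + `|x| * 0); last by rewrite mul0r mulr0 addr0.
by apply: cvgD; apply: cvgM => //; exact: cvg_cst.
Qed.

Lemma bounded_cvg (T : {linear V -> V}) (C : K) (u : nat -> V) x :
  (forall y, `|T y| <= C * `|y|) -> u @ \oo --> x ->
  (fun n => T (u n)) @ \oo --> T x.
Proof.
move=> TC ux; apply: (@cvg_dominated _ _ _ _ (fun n => C * `|u n - x|)).
  by move=> n; rewrite -linearB.
rewrite (_ : 0 = C * `|x - x|); last by rewrite subrr normr0 mulr0.
apply: cvgM; first exact: cvg_cst.
by apply: cvg_norm; apply: cvgB => //; exact: cvg_cst.
Qed.

Lemma cauchy_seq_cvg (u : nat -> V) :
  (forall e, 0 < e -> exists n, forall m, (n <= m)%N -> `|u n - u m| < e) ->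
  cvg (u @ \oo).
Proof.
move=> uC; apply/cauchy_cvgP; apply: cauchy_exP => e e0.
have [n un] := uC e e0; exists (u n); exists n => // m /= nm.
by rewrite -ball_normE /=; exact: un.
Qed.

(** Bessel: the partial sums of the squared norms increase and stay bounded,
    so they are Cauchy, and by Pythagoras so are those of the series. *)
Lemma orthogonal_series_cvg (v : nat -> V) (C : K) :
  (forall i j, i != j -> ip (v i) (v j) = 0) ->
  (forall n, \sum_(i < n) `|v i| ^+ 2 <= C) ->
  cvg ((fun n => \sum_(i < n) v i) @ \oo).
Proof.
move=> vo vC; apply: cauchy_seq_cvg => e e0.
have [|n un] := decreasing_cauchy Kok (u := fun n => C - \sum_(i < n) `|v i| ^+ 2)
   _ (exprn_gt0 2 e0).
  move=> n; rewrite subr_ge0 vC /= lerD2l lerN2 big_ord_recr /= lerDl.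
  by rewrite exprn_ge0.
exists n => m nm; rewrite -(ltr_pXn2r (n := 2)) ?nnegrE ?(ltW e0) //.
apply: le_lt_trans (un m nm); rewrite distrC.
rewrite [leRHS](_ : _ = \sum_(i < m) `|v i| ^+ 2 - \sum_(i < n) `|v i| ^+ 2).
  2: by ring.
have key p : `|\sum_(i < n + p) v i - \sum_(i < n) v i| ^+ 2
    = \sum_(i < n + p) `|v i| ^+ 2 - \sum_(i < n) `|v i| ^+ 2.
  elim: p => [|p IH]; first by rewrite addn0 !subrr normr0 expr0n.
  rewrite addnS !big_ord_recr /= addrAC -ipE (pythagoras ip_semi).
    by rewrite !ipE IH [RHS]addrAC.
  rewrite (formBl ip_semi) !(form_suml ip_semi) !big1 ?subrr //.
  - by move=> i _; rewrite vo // ltn_eqF // (leq_trans (ltn_ord i)) // leq_addr.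
  - by move=> i _; rewrite vo // ltn_eqF.
by have := key (m - n)%N; rewrite subnKC // => ->.
Qed.

Lemma linear_limit (T : nat -> V -> V) :
  (forall n a x y, T n (a *: x + y) = a *: T n x + T n y) ->
  (forall x, cvg ((fun n => T n x) @ \oo)) ->
  exists U : {linear V -> V}, forall x, (fun n => T n x) @ \oo --> U x.
Proof.
move=> Tl Tc; have [|U UE] := @linear_map_exists _ _ _ (fun x => lim ((fun n => T n x) @ \oo)).
  move=> a x y; apply: cvg_lim => //.
  under eq_fun do rewrite Tl.
  by apply: cvgD; [apply: cvgZr; exact: Tc|exact: Tc].
by exists U => x; rewrite UE; exact: Tc.
Qed.

End Sequences.

(** * Orthonormal expansions *)

Lemma dense_sequence {K : numFieldType} {V : normedModType K} :
  (exists2 D : set V, countable D & dense D) ->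
  exists d : nat -> V, forall x e, 0 < e -> exists n, `|x - d n| < e.
Proof.
move=> [D cD dD]; have [D0|[g]] := pfcard_geP cD.
  by have [x []] := dD setT (ex_intro _ 0 I) openT; rewrite D0.
exists g => x e e0; have [|y [/= xy Dy]] := dD (ball x e) _ (ball_open x e).
  by exists x; exact: ballxx.
have /(_ y Dy) [n _ gn] := 'surj_g.
by exists n; rewrite gn; move: xy; rewrite -ball_normE.
Qed.

Lemma cvg_ge0 {K : numFieldType} (u : nat -> K) (l : K) :
  (forall n, 0 <= u n) -> u @ \oo --> l -> 0 <= l.
Proof.
move=> u0 ul; suff -> : l = `|l| by [].
apply: (@cvg_unique _ _ (u @ \oo)) => //.
rewrite [X in X @ _](_ : u = fun n => `|u n|); first exact: cvg_norm.
by apply/funext => n; rewrite ger0_norm.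
Qed.

Lemma root_function {K : numFieldType} {theta : K -> K} : conj_scalars theta ->
  exists sq : K -> K, forall a, 0 <= a -> 0 <= sq a /\ sq a ^+ 2 = a.
Proof.
move=> Kok; have [|sq sqP] := @choice K K (fun a s => 0 <= a -> 0 <= s /\ s ^+ 2 = a).
  move=> a; have [a0|a0] := boolP (0 <= a); last by exists 0.
  by have [s s0 s2] := root_exists Kok a0; exists s.
by exists sq.
Qed.

Section Expansions.
Context {K : numFieldType} {theta : {rmorphism K -> K}}
  {V : completeNormedModType K} {dot : {dot V for theta}}.
Hypotheses (Kok : conj_scalars theta) (dotE : induces_norm dot)
  (Vsep : separable_space V).
Local Notation ip := (inner dot).

Section GramSchmidt.
Context {b : V -> V -> K} (bP : semi_inner (theta := theta) b).

(** The square root function sends 0 to 0 and 0^-1 = 0, so that a residual of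
    seminorm 0 contributes the zero vector instead of stopping the process. *)
Lemma gram_schmidt (d : nat -> V) : exists g : nat -> V,
  [/\ forall i j, i != j -> b (g i) (g j) = 0,
      forall i, b (g i) (g i) = 0 \/ b (g i) (g i) = 1
    & forall n, let r := d n - \sum_(i < n.+1) b (g i) (d n) *: g i in
      b r r = 0].
Proof.
have [sq sqP] := root_function Kok.
pose res s x := x - \sum_(g <- s) b g x *: g.
pose nxt s x := (sq (b (res s x) (res s x)))^-1 *: res s x.
pose gs := fix gs n : seq V :=
  if n is n'.+1 then rcons (gs n') (nxt (gs n') (d n')) else [::].
pose g n := nxt (gs n) (d n).
have sumg n (F : V -> V) : \sum_(x <- gs n) F x = \sum_(i < n) F (g i).
  elim: n => [|n IH]; first by rewrite big_nil big_ord0.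
  by rewrite /= -cats1 big_cat /= big_seq1 IH big_ord_recr.
have resE n x : res (gs n) x = x - \sum_(i < n) b (g i) x *: g i.
  by rewrite /res sumg.
have main n : (forall i, (i < n)%N -> b (g i) (g n) = 0) /\
    (b (g n) (g n) = 0 \/ b (g n) (g n) = 1).
  have [m] := ubnP n; elim: m n => // m IH n /ltnSE nm.
  have go i j : (i < n)%N -> (j < n)%N -> i != j -> b (g i) (g j) = 0.
    move=> ni nj; rewrite neq_ltn => /orP[] ij.
      by have [h _] := IH j (leq_trans nj nm); exact: h.
    have [/(_ j ij) h _] := IH i (leq_trans ni nm).
    by rewrite -(formC bP) h rmorph0.
  have gr i : (i < n)%N -> b (g i) (res (gs n) (d n)) = 0.
    move=> ni; rewrite resE (formBr bP) (form_sumr bP).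
    rewrite (bigD1 (Ordinal ni)) //= big1 ?addr0.
      rewrite (formZr bP); have [_ []] := IH i (leq_trans ni nm).
        by move=> h; rewrite h mulr0 subr0 (form_null Kok bP).
      by move=> ->; rewrite mulr1 subrr.
    move=> j ji; rewrite (formZr bP) go ?mulr0 //.
    by rewrite eq_sym -val_eqE in ji.
  split=> [i ni|]; first by rewrite (formZr bP) gr ?mulr0.
  rewrite (formZZ Kok bP); set r := res _ _.
  have [s0 s2] := sqP _ (form_ge0 bP r).
  have [->|r0] := eqVneq (b r r) 0; first by left; rewrite mulr0.
  right; rewrite ger0_norm ?invr_ge0 // -{2}s2 -exprMn mulVf ?expr1n //.
  by apply: contraNneq r0 => s00; rewrite -s2 s00 expr0n.
have go i j : i != j -> b (g i) (g j) = 0.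
  rewrite neq_ltn => /orP[] ij; first by have [h _] := main j; exact: h.
  by have [/(_ j ij) h _] := main i; rewrite -(formC bP) h rmorph0.
exists g; split=> // [i|n]; first by have [] := main i.
rewrite /= big_ord_recr /= opprD addrA -resE; set r := res _ _.
have gnr : g n = (sq (b r r))^-1 *: r by [].
have [s0 s2] := sqP _ (form_ge0 bP r).
have [r0|r0] := eqVneq (b r r) 0.
  have /eqP s00 : sq (b r r) == 0 by rewrite -sqrf_eq0 s2 r0.
  by rewrite gnr s00 invr0 scale0r scaler0 subr0.
have sN0 : sq (b r r) != 0 by apply: contraNneq r0 => h; rewrite -s2 h expr0n.
suff -> : b (g n) (d n) *: g n = r by rewrite subrr (form0l bP).
have -> : d n = r + \sum_(i < n) b (g i) (d n) *: g i.
  by rewrite /r resE subrK.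
rewrite (formDr bP) (form_sumr bP) big1 ?addr0.
  rewrite gnr (formZl bP) (conj_ge0 Kok) ?invr_ge0 // scalerA -{2}s2.
  by rewrite expr2 mulKf // divff // scale1r.
by move=> i _; rewrite (formZr bP) go ?mulr0 // neq_ltn ltn_ord orbT.
Qed.

(** The squared remainder of x after n terms is at most |x - d_i|^2 for i < n,
    because d_i itself is exhausted, up to a null vector, by the first terms.
    Vectors of seminorm 0 may occur in the family and change nothing in the
    sums. *)
Lemma parseval_family : (forall x, b x x <= `|x| ^+ 2) ->
  exists g : nat -> V,
  [/\ forall i j, i != j -> b (g i) (g j) = 0,
      forall i, b (g i) (g i) = 0 \/ b (g i) (g i) = 1,
      forall n x y, b (x - \sum_(i < n) b (g i) x *: g i)
          (y - \sum_(i < n) b (g i) y *: g i) =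
        b x y - \sum_(i < n) b x (g i) * b (g i) y
    & forall x y, (fun n => \sum_(i < n) b x (g i) * b (g i) y) @ \oo --> b x y].
Proof.
move=> ble; have [d dP] := dense_sequence Vsep.
have [g [go g01 gd]] := gram_schmidt d; exists g.
pose P n x := \sum_(i < n) b (g i) x *: g i.
have PB n x y : P n (x - y) = P n x - P n y.
  rewrite /P -sumrB; apply: eq_bigr => i _.
  by rewrite (formBr bP) scalerBl.
have gP n i x : (i < n)%N -> b (g i) (x - P n x) = 0.
  move=> ni; rewrite (formBr bP) (form_sumr bP).
  rewrite (bigD1 (Ordinal ni)) //= big1 ?addr0.
    rewrite (formZr bP); have [h|->] := g01 i.
      by rewrite h mulr0 subr0 (form_null Kok bP).
    by rewrite mulr1 subrr.
  move=> j ji; rewrite (formZr bP) go ?mulr0 //.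
  by rewrite eq_sym -val_eqE in ji.
have PP n x y : b (P n y) (x - P n x) = 0.
  rewrite (form_suml bP) big1 // => i _.
  by rewrite (formZl bP) gP ?mulr0.
have remE n x y : b (x - P n x) (y - P n y) = b x y - \sum_(i < n) b x (g i) * b (g i) y.
  rewrite (formBl bP) PP subr0 (formBr bP) (form_sumr bP).
  by congr (_ - _); apply: eq_bigr => i _; rewrite (formZr bP) mulrC.
have rem_le n m x : (n <= m)%N -> b (x - P m x) (x - P m x) <= b (x - P n x) (x - P n x).
  move=> /subnKC <-; elim: (m - n)%N => [|k IH]; first by rewrite addn0.
  apply: le_trans IH; rewrite addnS !remE lerD2l lerN2 big_ord_recr /= lerDl.
  by rewrite (form_sqr Kok bP) exprn_ge0.
have rem_lexx n x : b (x - P n x) (x - P n x) <= b x x.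
  by have := rem_le 0%N n x (leq0n _); rewrite {3 4}/P big_ord0 subr0.
have rem_d n i x : (i < n)%N -> b (x - P n x) (x - P n x) <= `|x - d i| ^+ 2.
  move=> ni; apply: le_trans (ble _).
  have r0 : b (d i - P n (d i)) (d i - P n (d i)) = 0.
    apply/eqP; rewrite eq_le (form_ge0 bP) andbT.
    by apply: le_trans (rem_le i.+1 n (d i) ni) _; rewrite gd.
  have -> : x - P n x = (x - d i - P n (x - d i)) + (d i - P n (d i)).
    by rewrite PB addrACA subrK -opprD subrK.
  rewrite (formDl bP) (form_null Kok bP _ r0) addr0.
  rewrite (formDr bP) -(formC bP (d i - _)) (form_null Kok bP _ r0) rmorph0 addr0.
  exact: rem_lexx.
split=> // x y; apply: cvg_of_sqr_norm; apply/cvgrPdist_lt => e e0.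
have y1 : 0 < b y y + 1 by rewrite ltr_wpDl // (form_ge0 bP).
have [s s0 s2] := root_exists Kok (ltW (divr_gt0 e0 y1)).
have sgt0 : 0 < s.
  rewrite lt_def s0 andbT; apply: contraTneq (divr_gt0 e0 y1) => h.
  by rewrite -s2 h expr0n ltxx.
have [i xi] := dP x s sgt0; exists i.+1 => // n /= ni.
rewrite sub0r normrN normrX normr_id distrC -remE.
apply: le_lt_trans (cauchy_schwarz Kok bP _ _) _.
have h1 : b (x - P n x) (x - P n x) < e / (b y y + 1).
  by apply: le_lt_trans (rem_d n i x ni) _; rewrite -s2 ltrXn2r.
apply: le_lt_trans (ler_wpM2l (form_ge0 bP _) (rem_lexx n y)) _.
apply: le_lt_trans (_ : _ <= b (x - P n x) (x - P n x) * (b y y + 1)) _.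
  by rewrite ler_wpM2l ?(form_ge0 bP) // lerDl.
by rewrite -ltr_pdivlMr.
Qed.

End GramSchmidt.
End Expansions.

(** * Adjoints and dilations *)

Section Adjoint.
Context {K : numFieldType} {theta : {rmorphism K -> K}}
  {V : completeNormedModType K} {dot : {dot V for theta}}.
Hypotheses (Kok : conj_scalars theta) (dotE : induces_norm dot).
Local Notation ip := (inner dot).
Let ipP := ip_semi dotE.

Lemma ip_combination (T : finType) (w w' : T -> V) (G : T -> T -> K) (c c' : T -> K) :
  (forall s t, ip (w s) (w' t) = G s t) ->
  ip (\sum_t c t *: w t) (\sum_t c' t *: w' t) =
  \sum_s \sum_t theta (c s) * G s t * c' t.
Proof.
move=> wG; rewrite (form_suml ipP); apply: eq_bigr => s _.
rewrite (formZl ipP) (form_sumr ipP) mulr_sumr; apply: eq_bigr => t _.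
by rewrite (formZr ipP) wG mulrCA [RHS]mulrC.
Qed.

Lemma sum_delta (T : finType) (c c' : T -> K) :
  \sum_s \sum_t theta (c s) * (s == t)%:R * c' t = \sum_t theta (c t) * c' t.
Proof.
apply: eq_bigr => s _; rewrite (bigD1 s) //= eqxx mulr1 big1 ?addr0 // => t ts.
by rewrite eq_sym (negbTE ts) mulr0 mul0r.
Qed.

Lemma bounded_operatorP (T : {linear V -> V}) :
  bounded_operator T <-> exists2 C : K, 0 <= C & forall x, `|T x| <= C * `|x|.
Proof.
rewrite /bounded_operator linear_boundedP; split.
  by move=> /pinfty_ex_gt0 [C C0 TC]; exists C => //; exact: ltW.
move=> [C C0 TC]; exists C; split; first exact: ger0_real.
by move=> r Cr x; apply: le_trans (TC x) _; rewrite ler_wpM2r // ltW.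
Qed.

(** The coordinates of T' y in a Parseval family f have to be the numbers
    <T f_l, y>.  They are square summable: for s the n-th partial sum of the
    candidate, |s|^2 = <T s, y> <= C |s| |y|. *)
Lemma adjoint_exists (Vsep : separable_space V) (T : {linear V -> V}) (C : K) :
  0 <= C -> (forall x, `|T x| <= C * `|x|) ->
  exists T' : {linear V -> V}, forall x y, ip (T x) y = ip x (T' y).
Proof.
move=> C0 TC.
have [|f [fo f01 fB fc]] := parseval_family Kok Vsep ipP.
  by move=> x; rewrite (ipE dotE).
pose v y l := ip (T (f l)) y *: f l.
have vo y i j : i != j -> ip (v y i) (v y j) = 0.
  by move=> ij; rewrite (formZl ipP) (formZr ipP) fo // !mulr0.
have fnull l : ip (f l) (f l) = 0 -> f l = 0.
  by rewrite (ipE dotE) => /eqP; rewrite sqrf_eq0 normr_eq0 => /eqP.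
have vn y l : `|v y l| ^+ 2 = `|ip (T (f l)) y| ^+ 2.
  rewrite -(ipE dotE) (formZZ Kok ipP); have [h|->] := f01 l; last by rewrite mulr1.
  by rewrite (fnull l h) linear0 !(form0l ipP) normr0 expr0n mulr0.
have vC y n : \sum_(l < n) `|v y l| ^+ 2 <= C ^+ 2 * `|y| ^+ 2.
  set q := \sum_(l < n) _; pose s := \sum_(l < n) v y l.
  have q0 : 0 <= q by apply: sumr_ge0 => l _; rewrite exprn_ge0.
  have sq : `|s| ^+ 2 = q.
    rewrite -(ipE dotE) /s (form_suml ipP); apply: eq_bigr => i _.
    rewrite (form_sumr ipP) (bigD1 i) //= (ipE dotE) big1 ?addr0 // => j ji.
    by rewrite vo // eq_sym.
  have Tsq : ip (T s) y = q.
    rewrite /s linear_sum (form_suml ipP); apply: eq_bigr => l _.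
    by rewrite linearZ (formZl ipP) vn (conj_mul Kok).
  have [->|qN0] := eqVneq q 0; first by rewrite mulr_ge0 ?exprn_ge0.
  have qgt : 0 < q by rewrite lt_def qN0.
  rewrite -(ler_pM2r qgt) -{3}sq -!exprMn -expr2.
  rewrite ler_pXn2r ?nnegrE ?mulr_ge0 //.
  rewrite -[leLHS]ger0_norm // -Tsq; apply: le_trans (ip_le Kok dotE _ _) _.
  by rewrite mulrAC ler_wpM2r.
have [||T' T'E] := @linear_limit _ V (fun n y => \sum_(l < n) v y l).
- move=> n a x y; rewrite scaler_sumr -big_split; apply: eq_bigr => l _ /=.
  by rewrite /v (formP ipP) scalerDl scalerA.
- by move=> y; apply: (orthogonal_series_cvg Kok dotE (vo y) (vC y)).
exists T' => x y.
have fx : (fun n => \sum_(l < n) ip (f l) x *: f l) @ \oo --> x.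
  apply: cvg_of_sqr_norm; rewrite -(subrr (ip x x)).
  apply: (@cvg_ext _ (fun n => ip x x - \sum_(i < n) ip x (f i) * ip (f i) x)) => [n|].
    by rewrite distrC -(ipE dotE) fB.
  by apply: cvgB; [exact: cvg_cst|exact: fc].
apply: (cvg_eq _ (cvg_ip Kok dotE (bounded_cvg TC fx) (cvg_cst y))
  (cvg_ip Kok dotE (cvg_cst x) (T'E y))) => n.
rewrite linear_sum (form_suml ipP) (form_sumr ipP); apply: eq_bigr => l _.
by rewrite linearZ (formZl ipP) (formZr ipP) (formC ipP) mulrC.
Qed.

(** U x is the sum of the c i t x *: w i t.  Its terms for distinct i are
    orthogonal and A-orthogonal, so that Gram matrix and compression are read
    off from the coefficients, and the series converges by orthogonality. *)
Lemma isometric_dilation (T : finType) (w : nat -> T -> V) (c : nat -> T -> V -> K)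
    (A : {linear V -> V}) (CA : K) (G : T -> T -> K) (q : V -> V -> K) :
  (forall x, `|A x| <= CA * `|x|) ->
  (forall i t a x y, c i t (a *: x + y) = a * c i t x + c i t y) ->
  (forall i s j t, ip (w i s) (w j t) = ((i == j) && (s == t))%:R) ->
  (forall i s j t, ip (w i s) (A (w j t)) = (i == j)%:R * G s t) ->
  (forall x y, (fun n => \sum_(i < n) \sum_t theta (c i t x) * c i t y) @ \oo
     --> ip x y) ->
  (forall x y, (fun n => \sum_(i < n) \sum_s \sum_t
     theta (c i s x) * G s t * c i t y) @ \oo --> q x y) ->
  exists U : {linear V -> V},
    [/\ forall x y, ip (U x) (U y) = ip x y,
        forall x y, ip (U x) (A (U y)) = q x y
      & forall z, (forall i t, ip z (w i t) = 0) -> forall x, ip z (U x) = 0].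
Proof.
move=> ACA cl wo wA c1 cq.
pose v x i := \sum_t c i t x *: w i t.
have vv x y i j : ip (v x i) (v y j) = (i == j)%:R * \sum_t theta (c i t x) * c i t y.
  rewrite (@ip_combination _ _ _ (fun s t => ((i == j) && (s == t))%:R)) //.
  have [<-|ij] := eqVneq i j; first by rewrite mul1r -sum_delta.
  by rewrite mul0r big1 // => s _; rewrite big1 // => t _; rewrite mulr0 mul0r.
have vAv x y i j : ip (v x i) (A (v y j)) =
    (i == j)%:R * \sum_s \sum_t theta (c i s x) * G s t * c i t y.
  rewrite [A _]linear_sum /=; under [X in ip _ X]eq_bigr do rewrite linearZ /=.
  rewrite (@ip_combination _ _ _ (fun s t => (i == j)%:R * G s t)) //.
  have [<-|ij] := eqVneq i j.
    by rewrite mul1r; apply: eq_bigr => s _; apply: eq_bigr => t _; rewrite mul1r.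
  by rewrite mul0r big1 // => s _; rewrite big1 // => t _; rewrite mul0r mulr0 mul0r.
have vC x n : \sum_(i < n) `|v x i| ^+ 2 <= ip x x.
  rewrite -subr_ge0.
  apply: (@cvg_ge0 _ (fun k => \sum_(i < n + k) `|v x i| ^+ 2 - \sum_(i < n) `|v x i| ^+ 2)).
    move=> k; rewrite big_split_ord /= addrAC subrr add0r.
    by apply: sumr_ge0 => i _; rewrite exprn_ge0.
  apply: cvgB; last exact: cvg_cst.
  have h : (fun k => \sum_(i < k) `|v x i| ^+ 2) @ \oo --> ip x x.
    apply: (cvg_ext _ (c1 x x)) => k.
    by apply: eq_bigr => i _; rewrite -(ipE dotE) vv eqxx mul1r.
  rewrite -(cvg_shiftn n) in h; apply: (cvg_ext _ h) => k /=.
  by rewrite addnC.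
have [||U UE] := @linear_limit _ V (fun n x => \sum_(i < n) v x i).
- move=> n a x y; rewrite scaler_sumr -big_split; apply: eq_bigr => i _ /=.
  rewrite /v scaler_sumr -big_split; apply: eq_bigr => t _ /=.
  by rewrite cl scalerDl scalerA.
- move=> x; apply: (orthogonal_series_cvg Kok dotE _ (vC x)) => i j ij.
  by rewrite vv (negbTE ij) mul0r.
exists U; split=> [x y|x y|z zw x].
- apply: (cvg_eq _ (cvg_ip Kok dotE (UE x) (UE y)) (c1 x y)) => n.
  rewrite (form_suml ipP); apply: eq_bigr => i _; rewrite (form_sumr ipP).
  rewrite (bigD1 i) //= vv eqxx mul1r [X in _ + X]big1 ?addr0 // => j ji.
  by rewrite vv eq_sym val_eqE (negbTE ji) mul0r.
- apply: (cvg_eq _ (cvg_ip Kok dotE (UE x) (bounded_cvg ACA (UE y))) (cq x y)) => n.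
  rewrite linear_sum (form_suml ipP); apply: eq_bigr => i _; rewrite (form_sumr ipP).
  rewrite (bigD1 i) //= vAv eqxx mul1r [X in _ + X]big1 ?addr0 // => j ji.
  by rewrite vAv eq_sym val_eqE (negbTE ji) mul0r.
- apply: (cvg_eq _ (cvg_ip Kok dotE (cvg_cst z) (UE x)) (cvg_cst (0 : K))) => n.
  rewrite (form_sumr ipP) big1 // => i _; rewrite (form_sumr ipP) big1 // => t _.
  by rewrite (formZr ipP) zw mulr0.
Qed.

End Adjoint.

Section Dilation.
Context {K : numFieldType} {theta : {rmorphism K -> K}}
  {V : completeNormedModType K} {dot : {dot V for theta}}.
Hypotheses (Kok : conj_scalars theta) (dotE : induces_norm dot)
  (Vsep : separable_space V).
Local Notation ip := (inner dot).
Let ipP := ip_semi dotE.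

(** The form of 1 - Y* Y, whose square root is the defect operator of Y. *)
Definition defect_form (Y : V -> V) (x y : V) : K := ip x y - ip (Y x) (Y y).

Lemma defect_semi_inner (Y : {linear V -> V}) : (forall x, `|Y x| <= `|x|) ->
  semi_inner (theta := theta) (defect_form Y).
Proof.
move=> Y1; split=> [x a y z|x y|x]; rewrite /defect_form.
- by rewrite linearP !(formP ipP); ring.
- by rewrite rmorphB !(formC ipP).
- by rewrite !(ipE dotE) subr_ge0 lerXn2r ?nnegrE.
Qed.

Lemma defect_telescope (Y : V -> V) a x y :
  \sum_(l < a.+1) (if l == 0 :> nat then ip else defect_form Y)
     (iter (a - l) Y x) (iter (a - l) Y y) = ip x y.
Proof.
elim: a x y => [|a IH] x y; first by rewrite big_ord1 /=.
rewrite big_ord_recr /= subnn /=.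
under eq_bigr => l _ do rewrite subSn ?leq_ord // !iterSr.
by rewrite IH /defect_form addrC subrK.
Qed.

(** With D = (1 - Y* Y)^(1/2), D_0 = 1 and D_l = D for l > 0, the map
    x |-> (m+1)^(-1/2) \sum_(l <= a) (D_l Y^(a-l) x) (x) e_(a,l) is an isometry
    because \sum_(l <= a) |D_l Y^(a-l) x|^2 = |x|^2 for each of the m+1 values
    of a; the same telescoping computes the m nonzero entries of the nilpotent
    shift, which is where m/(m+1) comes from. *)
Lemma contraction_dilation (m : nat) (w : nat -> 'I_m.+1 * 'I_m.+1 -> V)
    (A : {linear V -> V}) (CA r : K) (Y : {linear V -> V}) :
  (forall x, `|A x| <= CA * `|x|) -> (forall x, `|Y x| <= `|x|) ->
  (forall i s j t, ip (w i s) (w j t) = ((i == j) && (s == t))%:R) ->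
  (forall i s j t, ip (w i s) (A (w j t)) =
     (i == j)%:R * (r * ((s.2 == t.2) && (t.1 == s.1.+1 :> nat))%:R)) ->
  exists U : {linear V -> V},
    [/\ forall x y, ip (U x) (U y) = ip x y,
        forall x y, ip (U x) (A (U y)) = r * m%:R / m.+1%:R * ip x (Y y)
      & forall z, (forall i t, ip z (w i t) = 0) -> forall x, ip z (U x) = 0].
Proof.
move=> ACA Y1 wo wA.
pose bb l := if l == 0%N then ip else defect_form Y.
have bbP l : semi_inner (theta := theta) (bb l).
  by rewrite /bb; case: eqP => // _; exact: defect_semi_inner.
have bble l x : bb l x x <= `|x| ^+ 2.
  rewrite /bb; case: eqP => _; rewrite ?/defect_form !(ipE dotE) //.
  by rewrite lerBlDr lerDl exprn_ge0.
have /choice [gg ggP] : forall l, exists g : nat -> V, forall x y,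
    (fun n => \sum_(i < n) bb l x (g i) * bb l (g i) y) @ \oo --> bb l x y.
  by move=> l; have [g [_ _ _ gc]] := parseval_family Kok Vsep (bbP l) (bble l); exists g.
have m0 : 0 <= (m.+1%:R : K)^-1 by rewrite invr_ge0 ler0n.
have [s s0 s2] := root_exists Kok m0.
pose cn i a l x := if (l <= a)%N then s * bb l (gg l i) (iter (a - l) Y x) else 0.
have iterl n a x y : iter n Y (a *: x + y) = a *: iter n Y x + iter n Y y.
  by elim: n => //= n ->; rewrite linearP.
have cnc a a' l x y : (fun n => \sum_(i < n) theta (cn i a l x) * cn i a' l y) @ \oo -->
    (if (l <= a)%N && (l <= a')%N then
       s ^+ 2 * bb l (iter (a - l) Y x) (iter (a' - l) Y y) else 0).
  rewrite /cn; case: (l <= a)%N => /=; last first.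
    apply: (@cvg_ext _ (fun=> 0)) => [n|]; last exact: cvg_cst.
    by rewrite big1 // => i _; rewrite rmorph0 mul0r.
  case: (l <= a')%N; last first.
    apply: (@cvg_ext _ (fun=> 0)) => [n|]; last exact: cvg_cst.
    by rewrite big1 // => i _; rewrite mulr0.
  apply: (@cvg_ext _ (fun n => s ^+ 2 * (\sum_(i < n)
     bb l (iter (a - l) Y x) (gg l i) * bb l (gg l i) (iter (a' - l) Y y)))) => [n|].
    rewrite mulr_sumr; apply: eq_bigr => i _.
    by rewrite rmorphM (formC (bbP l)) (conj_ge0 Kok) // ; ring.
  by apply: cvgM; [exact: cvg_cst|exact: ggP].
have tele (a : 'I_m.+1) x y : \sum_(l < m.+1)
    (if (l <= a)%N then s ^+ 2 * bb l (iter (a - l) Y x) (iter (a - l) Y y) else 0)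
    = (m.+1%:R)^-1 * ip x y.
  rewrite -big_mkcond /= -mulr_sumr s2; congr (_ * _).
  rewrite -(defect_telescope Y a x y).
  by rewrite (big_ord_widen m.+1 (fun l => bb l (iter (a - l) Y x) (iter (a - l) Y y))).
pose c i (t : 'I_m.+1 * 'I_m.+1) x := cn i t.1 t.2 x.
apply: (isometric_dilation (CA := CA) (c := c) Kok dotE ACA _ wo wA).
- move=> i t a x y; rewrite /c /cn; case: ifP => _; last by rewrite mulr0 addr0.
  by rewrite iterl (formP (bbP _)); ring.
- move=> x y; apply: (@cvg_ext _ (fun n => \sum_t \sum_(i < n) theta (c i t x) * c i t y)) => [n|].
    by rewrite exchange_big.
  rewrite [X in _ --> X](_ : _ = \sum_(t : 'I_m.+1 * 'I_m.+1)
     (if (t.2 <= t.1)%N then s ^+ 2 * bb t.2 (iter (t.1 - t.2) Y x) (iter (t.1 - t.2) Y y)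
      else 0)).
    by apply: cvg_sum_fin => t _; have := cnc t.1 t.1 t.2 x y; rewrite andbb.
  rewrite -(pair_bigA _ (fun a l : 'I_m.+1 => if (l <= a)%N then
      s ^+ 2 * bb l (iter (a - l) Y x) (iter (a - l) Y y) else 0)) /=.
  rewrite (eq_bigr _ (fun a _ => tele a x y)) sumr_const card_ord -[RHS]mulr_natl.
  by rewrite mulrA divff ?mul1r // pnatr_eq0.
- move=> x y.
  have inner_sum i (t : 'I_m.+1 * 'I_m.+1) :
    \sum_(u : 'I_m.+1 * 'I_m.+1)
      theta (c i t x) * (r * ((t.2 == u.2) && (u.1 == t.1.+1 :> nat))%:R) * c i u y =
    if (t.1 < m)%N then r * (theta (c i t x) * cn i t.1.+1 t.2 y) else 0.
    case: ifPn => [tm|tm].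
      rewrite (bigD1 (Ordinal (tm : (t.1.+1 < m.+1)%N), t.2)) //= !eqxx /= mulr1.
      rewrite [X in _ + X]big1 ?addr0; first by rewrite /c /=; ring.
      move=> [u1 u2] /=; rewrite xpair_eqE -val_eqE /= negb_and eq_sym.
      by rewrite [u2 == _]eq_sym => /orP[] /negbTE h; rewrite ?h ?andbF /= ?mulr0 ?mul0r // eq_sym h andbF !(mulr0, mul0r).
    rewrite big1 // => u _; rewrite (_ : _ && _ = false) ?mulr0 ?mul0r //.
    apply/negP => /andP[_ /eqP h]; move: (ltn_ord u.1); rewrite h ltnS => h'.
    by rewrite h' in tm.
  apply: (@cvg_ext _ (fun n => \sum_(t : 'I_m.+1 * 'I_m.+1) \sum_(i < n)
      if (t.1 < m)%N then r * (theta (c i t x) * cn i t.1.+1 t.2 y) else 0)) => [n|].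
    rewrite exchange_big; apply: eq_bigr => i _; apply: eq_bigr => t _.
    by rewrite inner_sum.
  rewrite [X in _ --> X](_ : _ = \sum_(t : 'I_m.+1 * 'I_m.+1)
     (if (t.1 < m)%N then r * (if (t.2 <= t.1)%N then
       s ^+ 2 * bb t.2 (iter (t.1 - t.2) Y x) (iter (t.1 - t.2) Y (Y y)) else 0) else 0)).
    apply: cvg_sum_fin => t _; case: ifP => _.
      under eq_fun do rewrite -mulr_sumr.
      apply: cvgM; first exact: cvg_cst.
      have := cnc t.1 t.1.+1 t.2 x y.
      rewrite (_ : (_ <= _)%N && _ = (t.2 <= t.1)%N); last first.
        by case: leqP => //= /leqW ->.
      by case: leqP => // h; rewrite subSn // iterSr.
    by under eq_fun do rewrite big1 //; exact: cvg_cst.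
  rewrite -(pair_bigA _ (fun a l : 'I_m.+1 => if (a < m)%N then r * (if (l <= a)%N then
      s ^+ 2 * bb l (iter (a - l) Y x) (iter (a - l) Y (Y y)) else 0) else 0)) /=.
  rewrite (eq_bigr (fun a : 'I_m.+1 => if (a < m)%N then
     r * ((m.+1%:R)^-1 * ip x (Y y)) else 0)); last first.
    move=> a _; case: ifP => _; last by rewrite big1.
    by rewrite -mulr_sumr tele.
  rewrite big_ord_recr /= ltnn addr0 (eq_bigr (fun=> r * ((m.+1%:R)^-1 * ip x (Y y)))).
    by rewrite sumr_const card_ord -[RHS]mulr_natl; ring.
  by move=> a _; rewrite ltn_ord.
Qed.

End Dilation.

(** Dependent choice in the form used throughout: each new object may be asked
    to avoid a finite set that depends on all the previous ones. *)
Lemma greedy_sequence (T : Type) (U : eqType) (ext : T -> seq U)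
    (P : nat -> seq U -> T -> Prop) (L0 : seq U) :
  (forall n L, exists z, P n L z) ->
  exists Z : nat -> T, forall n, exists L,
    [/\ P n L (Z n), {subset L0 <= L}
      & forall i, (i < n)%N -> {subset ext (Z i) <= L}].
Proof.
move=> Pex; have /choice [pick pickP] : forall nL : nat * seq U, exists z, P nL.1 nL.2 z.
  by move=> nL; exact: Pex.
pose Ls := fix Ls n := if n is k.+1 then Ls k ++ ext (pick (k, Ls k)) else L0.
have subL n k : {subset Ls n <= Ls (n + k)%N}.
  elim: k => [|k IH] v vn; first by rewrite addn0.
  by rewrite addnS /= mem_cat IH.
exists (fun n => pick (n, Ls n)) => n; exists (Ls n); split.
- exact: (pickP (n, Ls n)).
- exact: (subL 0%N n).
- by move=> i /subnKC <- v vi; apply: subL; rewrite /= mem_cat vi orbT.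
Qed.

(** One unknown more than there are equations.  The coefficients are
    normalised to combine orthonormal vectors into a unit vector. *)
Lemma unit_combination {K : numFieldType} {theta : K -> K} (J : finType)
    (phi : nat -> J -> K) : conj_scalars theta ->
  exists c : 'I_#|J|.+1 -> K, \sum_s theta (c s) * c s = 1 /\
    forall j, \sum_s c s * phi s j = 0.
Proof.
move=> Kok; pose M := \matrix_(s < #|J|.+1, j < #|J|) phi s (enum_val j).
have : kermx M != 0.
  rewrite kermx_eq0 /row_free; apply/negP => /eqP h.
  by have := rank_leq_col M; rewrite h ltnn.
case/rowV0Pn => v; rewrite sub_kermx => /eqP vM vN0.
pose q := \sum_s `|v 0 s| ^+ 2.
have q0 : 0 <= q by apply: sumr_ge0 => s _; rewrite exprn_ge0.
have qN0 : q != 0.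
  apply: contraNneq vN0 => /eqP; rewrite psumr_eq0; last first.
    by move=> s _; rewrite exprn_ge0.
  move=> /allP h; apply/eqP/rowP => s; rewrite mxE.
  by have := h s (mem_index_enum _); rewrite sqrf_eq0 normr_eq0 => /eqP.
have [s s0 s2] := root_exists Kok q0.
exists (fun i => v 0 i / s); split.
  transitivity (\sum_i `|v 0 i| ^+ 2 / s ^+ 2).
    apply: eq_bigr => i _; rewrite (conj_mul Kok) normf_div expr_div_n.
    by rewrite (ger0_norm s0).
  by rewrite -mulr_suml s2 divff.
move=> j; transitivity ((v *m M) 0 (enum_rank j) / s).
  rewrite mxE mulr_suml; apply: eq_bigr => i _.
  by rewrite mxE enum_rankK mulrAC.
by rewrite vM mxE mul0r.
Qed.

(** * Shift blocks *)

Section Blocks.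
Context {K : numFieldType} {theta : {rmorphism K -> K}}
  {V : completeNormedModType K} {dot : {dot V for theta}}.
Hypotheses (Kok : conj_scalars theta) (dotE : induces_norm dot)
  (Vsep : separable_space V).
Local Notation ip := (inner dot).
Let ipP := ip_semi dotE.

(** The compressions of A to the range of F contain r times the nilpotent
    shift of size m+1, in general position with respect to any finite set of
    vectors. *)
Definition has_shift_blocks (A : V -> V) (r : K) (m : nat) (F : V -> V) : Prop :=
  forall L : seq V, exists z : 'I_m.+1 -> V,
    [/\ forall a, F (z a) = z a,
        forall v a, v \in L -> ip v (z a) = 0,
        forall a b, ip (z a) (z b) = (a == b)%:R
      & forall a b, ip (z a) (A (z b)) = r * (b == a.+1 :> nat)%:R].

Lemma shift_block_sequence (A B : {linear V -> V}) r m (F : V -> V) (L : seq V) :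
  (forall x y, ip (A x) y = ip x (B y)) -> has_shift_blocks A r m F ->
  exists Z : nat -> 'I_m.+1 -> V,
    [/\ forall i a, F (Z i a) = Z i a,
        forall i a v, v \in L -> ip v (Z i a) = 0,
        forall i a j b, ip (Z i a) (Z j b) = ((i == j) && (a == b))%:R
      & forall i a j b, ip (Z i a) (A (Z j b)) =
          (i == j)%:R * (r * (b == a.+1 :> nat)%:R)].
Proof.
move=> AB Fsh.
pose ext (z : 'I_m.+1 -> V) :=
  flatten [seq [:: z a; A (z a); B (z a)] | a <- enum 'I_m.+1].
have mem_ext z a v : v \in [:: z a; A (z a); B (z a)] -> v \in ext z.
  move=> vz; apply/flattenP; exists [:: z a; A (z a); B (z a)] => //.
  by apply/mapP; exists a; rewrite ?mem_enum.
have [Z ZP] := greedy_sequence ext L (fun _ => Fsh).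
have orth i j a b v : (i < j)%N -> v \in [:: Z i a; A (Z i a); B (Z i a)] -> ip v (Z j b) = 0.
  move=> ij vi; have [L' [[_ h _ _] _ sub]] := ZP j.
  by apply: h; apply: (sub i ij); exact: mem_ext vi.
have Bip x y : ip (B x) y = ip x (A y).
  by rewrite -(formC ipP) -AB (formC ipP).
exists Z; split=> [i a|i a v vL|i a j b|i a j b].
- by have [L' [[h _ _ _] _ _]] := ZP i; exact: h.
- by have [L' [[_ h _ _] sub _]] := ZP i; apply: h; exact: sub.
- have [ij|ji|->] := ltngtP i j.
  + by rewrite (orth i j a b) // inE eqxx.
  + by rewrite -(formC ipP) (orth j i b a) ?rmorph0 // inE eqxx.
  + by have [L' [[_ _ h _] _ _]] := ZP j; rewrite h.
- have [ij|ji|->] := ltngtP i j; rewrite ?mul0r.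
  + by rewrite -Bip (orth i j a b) // !inE eqxx !orbT.
  + by rewrite -(formC ipP) (orth j i b a) ?rmorph0 // !inE eqxx orbT.
  + by rewrite mul1r; have [L' [[_ _ _ h] _ _]] := ZP j; rewrite h.
Qed.

(** Any infinite sequence of mutually orthogonal and A-orthogonal blocks can be
    combined into a block that satisfies finitely many linear equations. *)
Lemma blocks_of_sequence (A : {linear V -> V}) r m (F : {linear V -> V})
    (Z : nat -> 'I_m.+1 -> V) :
  (forall i a, F (Z i a) = Z i a) ->
  (forall i a j b, ip (Z i a) (Z j b) = ((i == j) && (a == b))%:R) ->
  (forall i a j b, ip (Z i a) (A (Z j b)) = (i == j)%:R * (r * (b == a.+1 :> nat)%:R)) ->
  has_shift_blocks A r m F.
Proof.
move=> FZ ZZ ZA L.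
have [c [c1 cL]] := unit_combination
  (fun s (j : 'I_(size L) * 'I_m.+1) => ip (nth 0 L j.1) (Z s j.2)) Kok.
have comb (w w' : 'I__ -> V) g : (forall s t, ip (w s) (w' t) = (s == t)%:R * g) ->
    ip (\sum_s c s *: w s) (\sum_s c s *: w' s) = g.
  move=> wg; rewrite (ip_combination dotE _ _ wg).
  under eq_bigr => s _ do under eq_bigr => t _ do rewrite mulrA mulrAC.
  under eq_bigr => s _ do rewrite -mulr_suml.
  by rewrite -mulr_suml sum_delta c1 mul1r.
exists (fun a => \sum_s c s *: Z s a); split=> [a|v a vL|a b|a b].
- by rewrite linear_sum; apply: eq_bigr => s _; rewrite linearZ /= FZ.
- have iL : (index v L < size L)%N by rewrite index_mem.
  rewrite (form_sumr ipP); apply: etrans (cL (Ordinal iL, a)).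
  by apply: eq_bigr => s _; rewrite (formZr ipP) /= nth_index.
- by apply: comb => s t; rewrite ZZ -natrM mulnb.
- rewrite linear_sum; under [X in ip _ X]eq_bigr do rewrite linearZ /=.
  by apply: comb => s t; rewrite ZA.
Qed.

End Blocks.

Arguments has_shift_blocks {K theta V} dot A r m F.

(** * One step of the construction *)

Section OneStep.
Context {K : numFieldType} {theta : {rmorphism K -> K}}
  {V : completeNormedModType K} {dot : {dot V for theta}}.
Hypotheses (Kok : conj_scalars theta) (dotE : induces_norm dot)
  (Vsep : separable_space V).
Local Notation ip := (inner dot).
Let ipP := ip_semi dotE.

(** The operator that multiplies the unit vector h by c and is the identity on
    its orthogonal complement. *)
Definition stretch (h : V) (c : K) (x : V) : V := x + ((c - 1) * ip h x) *: h.

Lemma stretch_linear h c a x y :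
  stretch h c (a *: x + y) = a *: stretch h c x + stretch h c y.
Proof.
rewrite /stretch (formP ipP) scalerDr scalerA addrACA -scalerDl.
by congr (_ + _ *: _); ring.
Qed.

Lemma ip_stretch h c d x y : ip h h = 1 -> theta c = c ->
  ip (stretch h c x) (stretch h d y) = ip x y + (c * d - 1) * (ip x h * ip h y).
Proof.
move=> hh cc; rewrite (formDl ipP) !(formDr ipP) !(formZl ipP) !(formZr ipP) hh.
by rewrite rmorphM (formC ipP) rmorphB rmorph1 cc; ring.
Qed.

Lemma stretchK h c d x : ip h h = 1 -> d * c = 1 ->
  stretch h d (stretch h c x) = x.
Proof.
move=> hh dc; rewrite /stretch (formDr ipP) (formZr ipP) hh -addrA -scalerDl.
rewrite (_ : _ + _ = (d * c - 1) * ip h x); last by ring.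
by rewrite dc subrr mul0r scale0r addr0.
Qed.

Lemma norm_stretch h c x : ip h h = 1 -> 1 <= c -> `|stretch h c x| <= c * `|x|.
Proof.
move=> hh c1; have c0 : 0 <= c by apply: le_trans c1.
rewrite -(ler_pXn2r (n := 2)) ?nnegrE ?mulr_ge0 // exprMn -!(ipE dotE).
rewrite ip_stretch ?(conj_ge0 Kok) // (form_sqr Kok ipP).
rewrite -lerBrDl -{2}[ip x x]mul1r -mulrBl expr2 ler_wpM2l //.
  by rewrite subr_ge0 mulr_ege1.
by have := cauchy_schwarz Kok ipP x h; rewrite hh mulr1.
Qed.

(** The isometry is U = W S + al <h,.> h, where al^2 = t, S = stretch h be
    with be^2 = 1 - t, and W realises Y = (X with the part due to h removed)
    conjugated by S^-1 and divided by r m/(m+1).  The inequality on t says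
    exactly that Y is a contraction.  The range of W is orthogonal to h, A h and
    B h, which removes all cross terms. *)
Lemma compression_through_vector (m : nat) (A B F X : {linear V -> V})
    (CA r rho t : K) (h : V) :
  (forall x, `|A x| <= CA * `|x|) -> (forall x y, ip (A x) y = ip x (B y)) ->
  (forall x y, ip (F x) y = ip x (F y)) -> has_shift_blocks dot A r m F ->
  (forall x, `|X x| <= rho * `|x|) -> 0 <= CA -> 0 <= rho ->
  0 < t < 1 -> 0 < r * m%:R / m.+1%:R ->
  rho + t * CA <= (1 - t) * (r * m%:R / m.+1%:R) ->
  F h = h -> ip h h = 1 ->
  exists U U' : {linear V -> V},
    [/\ forall x y, ip (U x) (U y) = ip x y,
        forall x y, ip (U x) (A (U y)) = ip x (X y),
        forall x y, ip (U x) y = ip x (U' y),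
        forall x, F (U x) = U x
      & t <= `|U (U' h)| ^+ 2 /\ has_shift_blocks dot A r m (F \- (U \o U'))].
Proof.
move=> ACA AB Fsym Fsh Xrho CA0 rho0 /andP[t0 t1] k0 kt Fh hh.
set kap := r * _ / _ in k0 kt.
have kN0 : kap != 0 by rewrite gt_eqF.
have t1' : 0 < 1 - t by rewrite subr_gt0.
have [al al0 al2] := root_exists Kok (ltW t0).
have [be be0 be2] := root_exists Kok (ltW t1').
have beN0 : be != 0 by apply: contraTneq t1' => h0; rewrite -be2 h0 expr0n ltxx.
have be1 : be <= 1.
  rewrite -(ler_pXn2r (n := 2)) ?nnegrE // be2 expr1n.
  by rewrite lerBlDr lerDl ltW.
have bi1 : 1 <= be^-1.
  by rewrite invf_ge1 // lt_def beN0.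
have thal : theta al = al by exact: (conj_ge0 Kok).
have thbe : theta be = be by exact: (conj_ge0 Kok).
have [Z [FZ ZL ZZ ZA]] := shift_block_sequence dotE [:: h; A h; B h] AB Fsh.
(* Out of m+2 consecutive blocks, m+1 are used by the dilation and the last is
   kept in reserve for the complement. *)
pose w i (s : 'I_m.+1 * 'I_m.+1) := Z (i * m.+2 + s.2)%N s.1.
pose res i := Z (i * m.+2 + m.+1)%N.
have idx i j (a b : nat) : (a < m.+2)%N -> (b < m.+2)%N ->
    ((i * m.+2 + a == j * m.+2 + b) = (i == j) && (a == b))%N.
  move=> am bm; apply/eqP/andP => [e|[/eqP -> /eqP ->] //].
  have := congr1 (divn^~ m.+2) e; have := congr1 (modn^~ m.+2) e.
  rewrite /= !modnMDl !divnMDl // !modn_small // !divn_small // !addn0.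
  by move=> -> ->.
have lem (s : 'I_m.+1) : (s < m.+2)%N by rewrite ltnW // ltnS ltn_ord.
have wo i s j u : ip (w i s) (w j u) = ((i == j) && (s == u))%:R.
  rewrite ZZ idx // -andbA; congr ((_ && _)%:R).
  by case: s u => [s1 s2] [u1 u2]; rewrite xpair_eqE andbC.
have wA i s j u : ip (w i s) (A (w j u)) =
     (i == j)%:R * (r * ((s.2 == u.2) && (u.1 == s.1.+1 :> nat))%:R).
  rewrite ZA idx // -!mulnb !natrM; ring.
(* X minus the contribution t <h, A h> of h, conjugated by S^-1. *)
have [|Y YE] := @linear_map_exists _ V V (fun x => kap^-1 *: stretch h be^-1
   (X (stretch h be^-1 x) - (t * ip h (A h) * ip h (stretch h be^-1 x)) *: h)).
  move=> a x y; rewrite stretch_linear linearP (formP ipP).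
  rewrite [a *: (kap^-1 *: _)]scalerA [a * kap^-1]mulrC -[(kap^-1 * a) *: _]scalerA -scalerDr -stretch_linear.
  congr (_ *: stretch _ _ _); rewrite scalerBr scalerA addrACA -opprD -scalerDl.
  by congr (_ - _ *: _); ring.
have Y1 x : `|Y x| <= `|x|.
  rewrite YE normrZ ger0_norm ?invr_ge0 ?(ltW k0) // ler_pdivrMl //.
  apply: le_trans (norm_stretch _ hh bi1) _.
  have nh : `|h| = 1.
    by apply/eqP; rewrite -(@eqrXn2 _ 2) // -(ipE dotE) hh expr1n.
  set y := stretch h be^-1 x.
  have y1 : `|y| <= be^-1 * `|x| by exact: norm_stretch.
  apply: le_trans (_ : be^-1 * ((rho + t * CA) * `|y|) <= _).
    rewrite ler_wpM2l ?invr_ge0 //; apply: le_trans (ler_normB _ _) _.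
    rewrite mulrDl lerD // normrZ nh mulr1 !normrM (ger0_norm (ltW t0)).
    rewrite -!mulrA ler_wpM2l ?(ltW t0) //; apply: ler_pM => //.
      by apply: le_trans (ip_le Kok dotE _ _) _; rewrite nh mul1r (le_trans (ACA h)) // nh mulr1.
    by apply: le_trans (ip_le Kok dotE _ _) _; rewrite nh mul1r.
  rewrite ler_pdivrMl ?lt_def ?beN0 //.
  apply: le_trans (ler_wpM2l _ y1) _; first by rewrite addr_ge0 ?mulr_ge0 ?(ltW t0).
  rewrite mulrCA ler_pdivrMl ?lt_def ?beN0 // !mulrA -expr2 be2.
  by rewrite ler_wpM2r //; move: kt; rewrite /kap !mulrA.
have [W [Wiso WA Wort]] := contraction_dilation Kok dotE Vsep ACA Y1 wo wA.
have Wh x : ip h (W x) = 0 by apply: Wort => i s; rewrite ZL // inE eqxx.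
have Wh' x : ip (W x) h = 0 by rewrite -(formC ipP) Wh rmorph0.
have WAh x : ip (W x) (A h) = 0.
  rewrite -(formC ipP) (_ : ip (A h) _ = 0) ?rmorph0 //.
  by apply: Wort => i s; rewrite ZL // !inE eqxx orbT.
have hAW x : ip h (A (W x)) = 0.
  rewrite -(formC ipP) AB (formC ipP).
  by apply: Wort => i s; rewrite ZL // !inE eqxx !orbT.
have [|U UE] := @linear_map_exists _ V V (fun x => W (stretch h be x) + (al * ip h x) *: h).
  move=> a x y; rewrite stretch_linear linearP (formP ipP) scalerDr scalerA addrACA -scalerDl.
  by congr (_ + _ *: _); ring.
have Uiso x y : ip (U x) (U y) = ip x y.
  rewrite !UE (formDl ipP) !(formDr ipP) !(formZl ipP) !(formZr ipP) Wiso Wh Wh' hh.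
  rewrite ip_stretch // rmorphM thal (formC ipP) -expr2 be2.
  by rewrite -[t]al2; ring.
have UA x y : ip (U x) (A (U y)) = ip x (X y).
  rewrite !UE [A (_ + _)]linearD [A (_ *: _)]linearZ /= (formDl ipP) !(formDr ipP) !(formZl ipP) !(formZr ipP).
  rewrite WA WAh hAW -/kap YE stretchK ?mulVf // (formZr ipP) mulrA divff // mul1r.
  rewrite ip_stretch // mulfV // subrr mul0r addr0 (formBr ipP) (formZr ipP).
  by rewrite rmorphM thal (formC ipP) -[t]al2; ring.
have U1 x : `|U x| <= 1 * `|x|.
  by rewrite mul1r -(ler_pXn2r (n := 2)) ?nnegrE // -!(ipE dotE) Uiso.
have [U' U'E] := adjoint_exists Kok dotE Vsep ler01 U1.
exists U, U'; split=> // [x|].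
  apply: (ip_ext dotE) => z; apply/eqP; rewrite -Fsym -subr_eq0 -(formBl ipP).
  rewrite UE (formDr ipP) (formZr ipP) (formBl ipP _ _ h) Fsym Fh subrr mulr0 addr0.
  apply/eqP/Wort => i s; rewrite (formBl ipP) Fsym /w FZ subrr //.
split.
  have -> : `|U (U' h)| ^+ 2 = `|U' h| ^+ 2 by rewrite -!(ipE dotE) Uiso.
  have alE : al = ip h (U' h).
    by rewrite -U'E UE (formDl ipP) Wh' (formZl ipP) hh rmorphM thal rmorph1; ring.
  have := cauchy_schwarz Kok ipP h (U' h).
  by rewrite -alE hh mul1r (ger0_norm al0) al2 (ipE dotE).
have resU i a x : ip (U x) (res i a) = 0.
  rewrite UE (formDl ipP) (formZl ipP) (ZL _ _ h) ?inE ?eqxx // mulr0 addr0.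
  rewrite -(formC ipP) Wort ?rmorph0 // => j s.
  rewrite ZZ idx // [(m.+1 == s.2 :> nat)]gtn_eqF ?andbF //; exact: ltn_ord.
apply: (blocks_of_sequence (Z := res) Kok dotE) => [i a|i a j b|i a j b].
- have U'res : U' (res i a) = 0.
    by apply: (ip_ext dotE) => z; rewrite -U'E resU (form0r ipP).
  by rewrite /= U'res linear0 subr0 FZ.
- by rewrite ZZ idx // eqxx andbT.
- by rewrite ZA idx // eqxx andbT.
Qed.

End OneStep.

(** * Exhausting the space *)

Lemma recurrent_enumeration :
  exists tau : nat -> nat, forall j n, exists2 m, (n <= m)%N & tau m = j.
Proof.
exists (logn 2) => j n; exists (2 ^ j * n.*2.+1)%N.
  rewrite (leq_trans (_ : n <= n.*2.+1)%N) ?leq_pmull ?expn_gt0 //.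
  by rewrite -addnn ltnW // ltnS leq_addr.
rewrite lognM ?expn_gt0 // pfactorK // lognE /= dvdn2 /= odd_double.
by rewrite addn0.
Qed.

Section Pinching.
Context {K : numFieldType} {theta : {rmorphism K -> K}}
  {V : completeNormedModType K} {dot : {dot V for theta}}.
Hypotheses (Kok : conj_scalars theta) (dotE : induces_norm dot)
  (Vsep : separable_space V).
Local Notation ip := (inner dot).
Let ipP := ip_semi dotE.

Lemma shift_block_unit A r m (F : V -> V) : has_shift_blocks dot A r m F ->
  exists2 h, F h = h & ip h h = 1.
Proof.
move=> /(_ [::]) [z [Fz _ zz _]]; exists (z ord0) => //.
Qed.

Lemma compression_catching_vector (m : nat) (A B F X : {linear V -> V})
    (CA r rho t : K) (h : V) :
  (forall x, `|A x| <= CA * `|x|) -> (forall x y, ip (A x) y = ip x (B y)) ->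
  (forall x y, ip (F x) y = ip x (F y)) -> has_shift_blocks dot A r m F ->
  (forall x, `|X x| <= rho * `|x|) -> 0 <= CA -> 0 <= rho ->
  0 < t < 1 -> 0 < r * m%:R / m.+1%:R ->
  rho + t * CA <= (1 - t) * (r * m%:R / m.+1%:R) ->
  F h = h ->
  exists U U' : {linear V -> V},
    [/\ forall x y, ip (U x) (U y) = ip x y,
        forall x y, ip (U x) (A (U y)) = ip x (X y),
        forall x y, ip (U x) y = ip x (U' y),
        forall x, F (U x) = U x
      & t * `|h| ^+ 2 <= `|U (U' h)| ^+ 2 /\
        has_shift_blocks dot A r m (F \- (U \o U'))].
Proof.
move=> ACA AB Fsym Fsh Xrho CA0 rho0 t01 k0 kt Fh.
have step := compression_through_vector Kok dotE Vsep ACA AB Fsym Fsh Xrho CA0 rho0 t01 k0 kt.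
have [h0|hN0] := eqVneq h 0.
  have [g Fg gg] := shift_block_unit Fsh.
  have [U [U' [h1 h2 h3 h4 [_ h5]]]] := step g Fg gg.
  exists U, U'; split=> //; split=> //.
  by rewrite h0 !linear0 normr0 expr0n mulr0.
have nN0 : `|h| != 0 by rewrite normr_eq0.
have [||U [U' [h1 h2 h3 h4 [h5 h6]]]] := step (`|h|^-1 *: h).
- by rewrite linearZ /= Fh.
- rewrite (formZZ Kok ipP) (ipE dotE) -exprMn ger0_norm ?invr_ge0 //.
  by rewrite mulVf // expr1n.
exists U, U'; split=> //; split=> //.
move: h5; rewrite !linearZ /= normrZ ger0_norm ?invr_ge0 // exprMn exprVn.
by rewrite ler_pdivlMl ?exprn_gt0 ?normr_gt0 // mulrC.
Qed.

(** Each vector d_j of a dense sequence is treated infinitely often, and each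
    time a fixed proportion t of the squared norm of its residual is captured
    by the next projection. *)
Theorem pinching_of_shift_blocks (m : nat) (A : {linear V -> V})
    (X : nat -> {linear V -> V}) (r rho : K) :
  bounded_operator A -> has_shift_blocks dot A r m idfun ->
  (forall n x, `|X n x| <= rho * `|x|) -> 0 <= rho -> rho < r * m%:R / m.+1%:R ->
  exists E : nat -> {linear V -> V}, total_projections dot E /\
    forall n, compression_unitarily_equivalent dot A (E n) (X n).
Proof.
move=> /bounded_operatorP [CA CA0 ACA] Ash Xrho rho0 rk.
set kap := r * _ / _ in rk.
have k0 : 0 < kap by apply: le_lt_trans rk.
have [B AB] := adjoint_exists Kok dotE Vsep CA0 ACA.
have d0 : 0 < CA + kap + 1 by rewrite addr_gt0 // ltr_wpDl.
(* This t satisfies t (CA + kap) <= kap - rho. *)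
pose t := (kap - rho) / (CA + kap + 1).
have t0 : 0 < t by rewrite divr_gt0 // subr_gt0.
have t1 : t < 1.
  rewrite ltr_pdivrMr // mul1r ltrBlDr -addrA -addrA addrCA ltrDl.
  by rewrite ltr_wpDl // ltr_wpDr.
have tk : rho + t * CA <= (1 - t) * kap.
  rewrite mulrBl mul1r lerBrDr -addrA -mulrDr addrC -lerBrDr /t.
  rewrite mulrAC ler_pdivrMr // ler_wpM2l ?subr_ge0 ?(ltW rk) //.
  by rewrite lerDl.
pose inv (F : {linear V -> V}) := [/\ forall x y, ip (F x) y = ip x (F y),
  forall x, F (F x) = F x & has_shift_blocks dot A r m F].
pose good (F : {linear V -> V}) (h : V) (n : nat) (UU : {linear V -> V} * {linear V -> V}) :=
  let (U, U') := UU in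
  [/\ forall x y, ip (U x) (U y) = ip x y,
        forall x y, ip (U x) (A (U y)) = ip x (X n y),
        forall x y, ip (U x) y = ip x (U' y),
        forall x, F (U x) = U x
      & t * `|h| ^+ 2 <= `|U (U' h)| ^+ 2 /\
        has_shift_blocks dot A r m (F \- (U \o U'))].
have [pick pickP] : exists pick, forall s : {linear V -> V} * V * nat,
    inv s.1.1 -> s.1.1 s.1.2 = s.1.2 -> good s.1.1 s.1.2 s.2 (pick s).
  have /choice [pick pickP] : forall s : {linear V -> V} * V * nat, exists UU,
      inv s.1.1 -> s.1.1 s.1.2 = s.1.2 -> good s.1.1 s.1.2 s.2 UU.
    move=> [[F h] n] /=.
    have [[Fsym FF Fsh]|nF] := pselect (inv F); last by exists ((idfun : {linear V -> V}), (idfun : {linear V -> V})).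
    have [Fh|nh] := pselect (F h = h); last by exists ((idfun : {linear V -> V}), (idfun : {linear V -> V})).
    have [|U [U' UU]] := compression_catching_vector ACA AB Fsym Fsh (Xrho n) CA0 rho0 _ k0 tk Fh.
      by rewrite t0.
    by exists (U, U').
  by exists pick.
have [d dP] := dense_sequence Vsep.
have [tau tauP] := recurrent_enumeration.
have [F [U [U' [F0 FS0 goodn]]]] : exists F U U' : nat -> {linear V -> V},
    [/\ inv (F 0%N) /\ forall x, F 0%N x = x,
        forall n, F n.+1 = F n \- (U n \o U' n) :> {linear V -> V}
      & forall n, inv (F n) -> good (F n) (F n (d (tau n))) n (U n, U' n)].
  pose F := fix F n : {linear V -> V} := if n is n'.+1 then
      let UU := pick (F n', F n' (d (tau n')), n') in F n' \- (UU.1 \o UU.2)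
    else idfun.
  exists F, (fun n => (pick (F n, F n (d (tau n)), n)).1),
    (fun n => (pick (F n, F n (d (tau n)), n)).2); split=> // n iF.
  have := pickP (F n, F n (d (tau n)), n) iF; rewrite /=; case: (pick _) => [u u'] h.
  by apply: h; case: iF.
have [E EU] : exists E : nat -> {linear V -> V}, forall n x, E n x = U n (U' n x).
  by exists (fun n => U n \o U' n).
have FS n x : F n.+1 x = F n x - E n x by rewrite FS0 /= EU.
have U'U n x : inv (F n) -> U' n (U n x) = x.
  by move=> /goodn [Uiso _ U'E _ _]; apply: (ip_ext dotE) => y; rewrite -U'E Uiso.
have Esym n x y : inv (F n) -> ip (E n x) y = ip x (E n y).
  move=> /goodn [Uiso _ U'E _ _]; rewrite !EU U'E -[RHS](formC ipP) U'E.
  by rewrite (formC ipP).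
have FE n x : inv (F n) -> F n (E n x) = E n x.
  by move=> /goodn [_ _ _ FU _]; rewrite EU FU.
have EF n x : inv (F n) -> E n (F n x) = E n x.
  move=> iF; apply: (ip_ext dotE) => y; rewrite -!Esym //.
  by case: (iF) => Fsym _ _; rewrite -Fsym FE.
have EE n x : inv (F n) -> E n (E n x) = E n x by move=> iF; rewrite !EU U'U.
have Finv n : inv (F n).
  elim: n => [|n iF]; first by case: F0.
  have [_ _ _ _ [_ sh]] := goodn n iF; split; last by rewrite FS0.
  - move=> x y; rewrite !FS (formBl ipP) (formBr ipP) Esym //.
    by case: iF => Fsym _ _; rewrite Fsym.
  - move=> x; rewrite !FS !linearB /= EF // EE // FE //; case: iF => _ -> _.
    by rewrite subrr addr0.
have F0x x : F 0%N x = x by case: F0.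
have Fpart n x : F n x = x - \sum_(j < n) E j x.
  elim: n => [|n IH]; first by rewrite big_ord0 subr0; case: F0.
  by rewrite FS IH big_ord_recr /= opprD addrA.
have FnE k n x : F (n + k)%N (F n x) = F (n + k)%N x.
  elim: k => [|k IH]; first by rewrite addn0; case: (Finv n).
  rewrite addnS !FS IH; congr (_ - _).
  by rewrite -EF // IH EF.
have EmF n k x : E n (F (n.+1 + k)%N x) = 0.
  elim: k x => [|k IH] x; first by rewrite addn0 FS linearB /= EF // EE // subrr.
  by rewrite addnS FS linearB IH -(FE (n.+1 + k)%N) // IH subr0.
have EEn n k x : (n < k)%N -> E n (E k x) = 0.
  by move=> /subnKC nk; rewrite -(FE k) // -{1}nk EmF.
have EEz n k x : n != k -> E n (E k x) = 0.
  rewrite neq_ltn => /orP[/EEn-> //|kn]; apply: (ip_ext dotE) => y.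
  by rewrite -Esym // -Esym // EEn // (form0l ipP) (form0r ipP).
have Fdec n x : `|F n.+1 x| ^+ 2 = `|F n x| ^+ 2 - `|E n x| ^+ 2.
  have -> : F n x = F n.+1 x + E n x by rewrite FS subrK.
  rewrite -!(ipE dotE) (pythagoras ipP) ?addrK // FS (formBl ipP).
  by rewrite -!Esym // EF // EE // subrr.
have Fmono n k x : (n <= k)%N -> `|F k x| <= `|F n x|.
  move=> /subnKC <-; elim: (k - n)%N => [|p IH]; first by rewrite addn0.
  apply: le_trans IH; rewrite addnS -(ler_pXn2r (n := 2)) ?nnegrE // Fdec.
  by rewrite lerBlDr lerDl exprn_ge0.
have Fd j e : 0 < e -> exists n, `|F n (d j)| < e.
  move=> e0; have te : 0 < t * e ^+ 2 by rewrite mulr_gt0 // exprn_gt0.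
  have [|n nP] := decreasing_cauchy Kok (u := fun n => `|F n (d j)| ^+ 2) _ te.
    by move=> n; rewrite exprn_ge0 //= lerXn2r ?nnegrE ?Fmono.
  have [k nk tk'] := tauP j n; exists k.
  have := nP k.+1 (leqW nk); rewrite Fdec => h.
  rewrite -(ltr_pXn2r (n := 2)) ?nnegrE ?(ltW e0) // -(ltr_pM2l t0).
  apply: le_lt_trans h.
  have [_ _ _ _ [hk _]] := goodn k (Finv k).
  rewrite tk' in hk; apply: le_trans hk _.
  rewrite -EU EF // opprB addrCA lerDl subr_ge0.
  by rewrite lerXn2r ?nnegrE ?Fmono.
have Eproj n : is_projection dot (E n).
  split; [|by move=> x; exact: EE|by move=> x y; exact: Esym].
  apply/bounded_operatorP; exists 1 => // x; rewrite mul1r.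
  rewrite -(ler_pXn2r (n := 2)) ?nnegrE //.
  have -> : `|E n x| ^+ 2 = `|F n x| ^+ 2 - `|F n.+1 x| ^+ 2 by rewrite Fdec opprB addrC subrK.
  rewrite lerBlDr (le_trans (_ : _ <= `|x| ^+ 2)) ?lerDl ?exprn_ge0 //.
  by rewrite lerXn2r ?nnegrE // -{2}[x]F0x (Fmono 0%N).
have [g _ gg] := shift_block_unit Ash.
exists E; split; last first.
  move=> n; have [Uiso UA U'E FU _] := goodn n (Finv n).
  exists (U n); split=> //.
    apply/seteqP; split=> [_ [x _ <-]|_ [x _ <-]]; last by exists (U' n x).
    by exists (U n x) => //; rewrite EU U'U.
  move=> x; rewrite /compression !EU U'U //; congr (U n _).
  by apply: (ip_ext dotE) => y; rewrite -U'E UA.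
split=> [//|n|n k nk x|x]; [|exact: EEz|].
  have [Uiso _ _ _ _] := goodn n (Finv n).
  exists (U n g); rewrite EU U'U //; apply/eqP => Ug0.
  have := Uiso g g; rewrite gg Ug0 (form0l ipP) => /eqP.
  by rewrite eq_sym oner_eq0.
apply/cvgrPdist_lt => e e0; have e2 : 0 < e / 2 by rewrite divr_gt0.
have [j xj] := dP x _ e2; have [n Fn] := Fd j _ e2.
exists n => // k /= nk; rewrite /series /= big_mkord -Fpart.
apply: le_lt_trans (Fmono n k x nk) _.
have -> : x = (x - d j) + d j by rewrite subrK.
rewrite linearD (le_lt_trans (ler_normD _ _)) // [e]splitr ltrD //.
by apply: le_lt_trans xj; have := Fmono 0%N n (x - d j) (leq0n n); rewrite F0x.
Qed.

End Pinching.

(** * Values of the quadratic form on the complex space *)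

(** For a prime N, any root of 1 + X + ... + X^(N-1) is primitive. *)
Lemma primitive_root_large (C : numClosedFieldType) (m : nat) :
  exists N (w : C), (m < N)%N /\ N.-primitive_root w.
Proof.
have [N mN Npr] := prime_above m; exists N.
have N1 := prime_gt1 Npr.
pose p : {poly C} := \poly_(i < N) 1.
have /closed_rootP [w] : size p != 1%N.
  by rewrite size_poly_eq ?oner_eq0 // gtn_eqF.
rewrite /root horner_poly => /eqP; under eq_bigr do rewrite mul1r.
move=> w0; exists w; split=> //.
have wN : w ^+ N = 1 by apply/eqP; rewrite -subr_eq0 subrX1 w0 mulr0.
have [k kw kN] := prim_order_exists (prime_gt0 Npr) wN.
case/primeP: Npr => _ /(_ k kN) /orP[/eqP k1|/eqP <- //].
move: kw; rewrite k1 => /prim_expr_order; rewrite expr1 => w1.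
move: w0; rewrite w1; under eq_bigr do rewrite expr1n.
by rewrite sumr_const card_ord => /eqP; rewrite pnatr_eq0 gtn_eqF // ltnW.
Qed.

Lemma geometric_sum0 (C : fieldType) (q : C) N :
  q ^+ N = 1 -> q != 1 -> \sum_(k < N) q ^+ k = 0.
Proof.
move=> qN q1; apply: (mulfI (_ : q - 1 != 0)); first by rewrite subr_eq0.
by rewrite -subrX1 qN subrr mulr0.
Qed.

Section ComplexValues.
Context {C : numClosedFieldType} {V : completeNormedModType C}
  {dot : {dot V for @Num.conj C}}.
Hypotheses (Kok : conj_scalars (@Num.conj C)) (dotE : induces_norm dot).
Local Notation ip := (inner dot).
Let ipP := ip_semi dotE.

Lemma bessel (e : nat -> V) (v : V) n : orthonormal_seq dot e ->
  \sum_(k < n) `|ip (e k) v| ^+ 2 <= `|v| ^+ 2.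
Proof.
move=> eo; pose s := \sum_(k < n) ip (e k) v *: e k.
have ee k : ip (e k) s = if (k < n)%N then ip (e k) v else 0.
  rewrite (form_sumr ipP); case: ltnP => kn.
    rewrite (bigD1 (Ordinal kn)) //= (formZr ipP) eo eqxx mulr1 big1 ?addr0 //.
    move=> j jk; rewrite (formZr ipP) eo [_ == _ :> nat]eq_sym.
    by rewrite -val_eqE in jk; rewrite (negbTE jk) mulr0.
  rewrite big1 // => j _; rewrite (formZr ipP) eo gtn_eqF ?mulr0 //.
  exact: leq_trans (ltn_ord j) kn.
have sx x : ip s x = \sum_(k < n) (ip (e k) v)^* * ip (e k) x.
  by rewrite (form_suml ipP); apply: eq_bigr => k _; rewrite (formZl ipP).
have ss : ip s s = \sum_(k < n) `|ip (e k) v| ^+ 2.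
  by rewrite sx; apply: eq_bigr => k _; rewrite ee ltn_ord (conj_mul Kok).
have sv : ip s v = \sum_(k < n) `|ip (e k) v| ^+ 2.
  by rewrite sx; apply: eq_bigr => k _; rewrite (conj_mul Kok).
rewrite -ss -(ipE dotE) -[X in _ <= ip X X](subrK s) -subr_ge0.
have vs : ip v s = ip s s.
  by rewrite -(formC ipP s v) sv -ss (conj_ge0 Kok) ?(form_ge0 ipP).
rewrite (pythagoras ipP); first by rewrite addrK (form_ge0 ipP).
by rewrite (formBl ipP) vs subrr.
Qed.

(** An orthonormal sequence tends weakly to 0, by Bessel's inequality. *)
Lemma orthonormal_weak (e : nat -> V) (v : V) (eps : C) : orthonormal_seq dot e ->
  0 < eps -> exists n, forall k, (n <= k)%N -> `|ip v (e k)| < eps.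
Proof.
move=> eo e0.
have [|n nP] := decreasing_cauchy Kok
    (u := fun n => `|v| ^+ 2 - \sum_(k < n) `|ip (e k) v| ^+ 2) _ (exprn_gt0 2 e0).
  move=> n; rewrite subr_ge0 bessel //= lerD2l lerN2 big_ord_recr /= lerDl.
  by rewrite exprn_ge0.
exists n => k nk; rewrite -(formC ipP) norm_conjC.
rewrite -(ltr_pXn2r (n := 2)) ?nnegrE ?(ltW e0) //.
apply: le_lt_trans (nP k.+1 (leqW nk)).
rewrite [leRHS](_ : _ = \sum_(i < k.+1) `|ip (e i) v| ^+ 2 -
   \sum_(i < n) `|ip (e i) v| ^+ 2); last by ring.
rewrite big_ord_recr /= addrAC lerDr subr_ge0.
by rewrite -(subnKC nk) big_split_ord /= lerDl sumr_ge0.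
Qed.

Lemma orthonormal_weak_seq (e : nat -> V) (L : seq V) (eps : C) :
  orthonormal_seq dot e -> 0 < eps ->
  exists n, forall k, (n <= k)%N -> forall v, v \in L -> `|ip v (e k)| < eps.
Proof.
move=> eo e0; elim: L => [|v L [n IH]]; first by exists 0%N.
have [p pP] := orthonormal_weak v eo e0; exists (maxn n p) => k.
rewrite geq_max => /andP[nk pk] x; rewrite inE => /orP[/eqP ->|xL].
  exact: pP.
exact: IH.
Qed.

Variables (A B : {linear V -> V}).
Hypothesis AB : forall x y, ip (A x) y = ip x (B y).

Lemma ip_adjoint x y : ip (B x) y = ip x (A y).
Proof. by rewrite -(formC ipP) -AB (formC ipP). Qed.

(** Values of z |-> <z, A z> that no finite set of orthogonality conditions
    rules out.  Imposing orthogonality to the earlier vectors and to their images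
    under A and B makes the vectors of a sequence A-orthogonal. *)
Definition persistent (D : set C) : Prop :=
  forall L : seq V, exists z, [/\ ip z z = 1, forall v, v \in L -> ip v z = 0
    & D (ip z (A z))].

(** Terms of e can be picked one after the other with all the entries
    <e_i, A e_j> - l delta_ij below eta; then every unit combination of N of its vectors has a value within N^2 eta
    of l, and one of them solves the orthogonality conditions. *)
Lemma persistent_limit (e : nat -> V) (l eps : C) : orthonormal_seq dot e ->
  (fun n => ip (e n) (A (e n))) @ \oo --> l -> 0 < eps ->
  persistent [set w | `|w - l| < eps].
Proof.
move=> eo el e0 L.
pose J : finType := 'I_(size L).
pose N := #|J|.+1.
pose eta := eps / (N ^ 2).+1%:R.
have h0 : 0 < eta by rewrite divr_gt0 // ltr0n.
move/cvgrPdist_lt/(_ _ h0): el => [p0 _ el].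
(* The bound by 1 on |<e_i, e_j>| only serves to keep the indices distinct. *)
pose ext k := [:: e k; A (e k); B (e k)].
have [|Z ZP] := greedy_sequence ext [::] (P := fun _ M k => (p0 <= k)%N /\
    forall v, v \in M -> `|ip v (e k)| < eta /\ `|ip v (e k)| < 1).
  move=> _ M; have [p1 h1] := orthonormal_weak_seq M eo h0.
  have [p2 h2] := orthonormal_weak_seq M eo ltr01.
  exists (maxn p0 (maxn p1 p2)); rewrite leq_maxl; split=> // v vM.
  by rewrite h1 ?h2 // !leq_max leqnn ?orbT.
have small i j v : (i < j)%N -> v \in ext (Z i) -> `|ip v (e (Z j))| < eta /\ `|ip v (e (Z j))| < 1.
  by move=> ij vi; have [M [[_ h] _ sub]] := ZP j; apply: h; exact: (sub i ij).
have Zneq i j : (i < j)%N -> Z i != Z j.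
  move=> ij; apply/eqP => Zij.
  have [_] := small i j (e (Z i)) ij (mem_head _ _).
  by rewrite eo Zij eqxx normr1 ltxx.
have Zo i j : ip (e (Z i)) (e (Z j)) = (i == j)%:R.
  rewrite eo; congr ((nat_of_bool _)%:R); have [ij|ji|->] := ltngtP i j; last exact: eqxx.
    exact/negbTE/Zneq.
  by rewrite eq_sym; exact/negbTE/Zneq.
pose y i j := ip (e (Z i)) (A (e (Z j))) - l * (i == j)%:R.
have ysmall i j : `|y i j| <= eta.
  rewrite /y; have [ij|ji|->] := ltngtP i j; rewrite ?mulr0 ?subr0 ?mulr1.
  - rewrite -ip_adjoint; have [h _] := small i j (B (e (Z i))) ij ltac:(by rewrite !inE eqxx !orbT).
    exact: ltW.
  - rewrite -(formC ipP) norm_conjC.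
    by have [/ltW h _] := small j i (A (e (Z j))) ji ltac:(by rewrite !inE eqxx !orbT).
  - rewrite distrC; apply: ltW; apply: el.
    by have [M [[h _] _ _]] := ZP j.
have [c [c1 cL]] := unit_combination (fun s (j : J) => ip (nth 0 L j) (e (Z s))) Kok.
pose z := \sum_s c s *: e (Z s).
have zG (G : nat -> nat -> C) (w : nat -> V) : (forall s t, ip (e (Z s)) (w t) = G s t) ->
    ip z (\sum_(s < N) c s *: w s) = \sum_(s < N) \sum_(t < N) (c s)^* * G s t * c t.
  by move=> h; exact: (ip_combination dotE).
exists z; split.
- have := zG _ (fun s => e (Z s)) Zo; rewrite -/z => ->; rewrite -[RHS]c1 -[RHS](sum_delta (theta := @Num.conj C)).
  by apply: eq_bigr => s _; apply: eq_bigr => t _; rewrite -val_eqE.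
- move=> v vL; have iL : (index v L < size L)%N by rewrite index_mem.
  rewrite (form_sumr ipP); apply: etrans (cL (Ordinal iL)).
  by apply: eq_bigr => s _; rewrite (formZr ipP) /= nth_index.
- rewrite /= linear_sum; under [X in ip _ X]eq_bigr do rewrite linearZ /=.
  rewrite (zG (fun s t => y s t + l * (s == t)%:R) (fun t => A (e (Z t)))); last first.
    by move=> s t; rewrite subrK.
  have -> : \sum_(s < N) \sum_(t < N) (c s)^* * (y s t + l * (s == t :> nat)%:R) * c t - l =
      \sum_(s < N) \sum_(t < N) (c s)^* * y s t * c t.
    apply/eqP; rewrite subr_eq; apply/eqP.
    transitivity (\sum_(s < N) \sum_(t < N) (c s)^* * y s t * c t +
       l * \sum_(s < N) \sum_(t < N) (c s)^* * (s == t)%:R * c t).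
      rewrite mulr_sumr -big_split; apply: eq_bigr => s _ /=.
      rewrite mulr_sumr -big_split; apply: eq_bigr => t _ /=.
      by rewrite -val_eqE; ring.
    congr (_ + _); rewrite (sum_delta (theta := @Num.conj C)).
    by rewrite [X in l * X](_ : _ = 1) ?mulr1.
  have cle s : `|c s| <= 1.
    rewrite -(ler_pXn2r (n := 2)) ?nnegrE // expr1n -c1 (bigD1 s) //=.
    rewrite (conj_mul Kok) lerDl sumr_ge0 // => t _.
    by rewrite (conj_mul Kok) exprn_ge0.
  apply: le_lt_trans (_ : \sum_(s < N) \sum_(t < N) eta < eps).
    apply: le_trans (ler_norm_sum _ _ _) _; apply: ler_sum => s _.
    apply: le_trans (ler_norm_sum _ _ _) _; apply: ler_sum => t _.
    rewrite !normrM norm_conjC -[leRHS]mulr1 ler_pM ?mulr_ge0 //.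
    by rewrite -[leRHS]mul1r ler_pM.
  rewrite !sumr_const !card_ord -mulrnA mulnn -mulr_natr /eta.
  rewrite mulrAC ltr_pdivrMr ?ltr0n // ltr_pM2l // ltr_nat.
  exact: ltnSn.
Qed.

(** Two orthogonal and A-orthogonal unit vectors z1, z2 give the value
    t <z1,Az1> + (1-t) <z2,Az2> at t^(1/2) z1 + (1-t)^(1/2) z2. *)
Lemma persistent_segment (D1 D2 D3 : set C) : persistent D1 -> persistent D2 ->
  (forall z1 z2, D1 z1 -> D2 z2 ->
     exists2 t, 0 <= t <= 1 & D3 (t * z1 + (1 - t) * z2)) ->
  persistent D3.
Proof.
move=> h1 h2 h3 L; have [x [xx xL xD]] := h1 L.
have [y [yy yL yD]] := h2 ([:: x; A x; B x] ++ L).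
have [t /andP[t0 t1] tD] := h3 _ _ xD yD.
have [a a0 a2] := root_exists Kok t0.
have t1' : 0 <= 1 - t by rewrite subr_ge0.
have [b b0 b2] := root_exists Kok t1'.
have ca := conj_ge0 Kok a0.
have cb := conj_ge0 Kok b0.
have xy : ip x y = 0 by apply: yL; rewrite !inE eqxx.
have Axy : ip (A x) y = 0 by apply: yL; rewrite !inE eqxx orbT.
have Bxy : ip (B x) y = 0 by apply: yL; rewrite !inE eqxx !orbT.
have yx : ip y x = 0 by rewrite -(formC ipP) xy rmorph0.
have yAx : ip y (A x) = 0 by rewrite -(formC ipP) Axy rmorph0.
have xAy : ip x (A y) = 0 by rewrite -ip_adjoint.
exists (a *: x + b *: y); split.
- rewrite (formDl ipP) !(formDr ipP) !(formZl ipP) !(formZr ipP) xx yy xy yx ca cb.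
  by rewrite !(mulr0, addr0, add0r, mulr1) -!expr2 a2 b2 addrC subrK.
- move=> v vL; rewrite (formDr ipP) !(formZr ipP) xL // yL ?mulr0 ?addr0 //.
  by rewrite mem_cat vL orbT.
- rewrite linearD !linearZ /= (formDl ipP) !(formDr ipP) !(formZl ipP) !(formZr ipP).
  rewrite xAy yAx ca cb !(mulr0, addr0, add0r) !mulrA -!expr2 a2 b2.
  exact: tD.
Qed.

Lemma normr_Re_le (z : C) : `|'Re z| <= `|z|.
Proof. by have [] := leif_normC_Re_Creal z. Qed.

Lemma normr_Im_le (z : C) : `|'Im z| <= `|z|.
Proof.
rewrite -(ler_pXn2r (n := 2)) ?nnegrE // [leRHS]normC2_Re_Im.
by rewrite real_normK ?Creal_Im // lerDr real_exprn_even_ge0 // Creal_Re.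
Qed.

Lemma convex_zero (a b : C) : 0 < a -> b < 0 ->
  exists2 t, 0 <= t <= 1 & t * a + (1 - t) * b = 0.
Proof.
move=> a0 b0; have d0 : 0 < a - b by rewrite subr_gt0 (lt_trans b0).
exists (- b / (a - b)); last by field; rewrite gt_eqF.
rewrite divr_ge0 ?oppr_ge0 ?ltW //= ltr_pdivrMr // mul1r.
by rewrite -subr_gt0 opprK subrK.
Qed.

(** Values in the four open quadrants around l, all approximable, combine to
    values on the two vertical half-lines and then to l itself. *)
Lemma persistent_value (l : C) :
  [set z : C | `|z| < 1] `<=` ess_num_range dot A -> `|l| < 1 ->
  persistent [set l].
Proof.
move=> AWe l1; pose d := (1 - `|l|) / 4.
have d0 : 0 < d by rewrite divr_gt0 // subr_gt0.
have quadrant (s t : C) : s ^+ 2 = 1 -> t ^+ 2 = 1 -> s \is Num.real -> t \is Num.real ->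
  persistent [set w | 0 < s * 'Re (w - l) /\ 0 < t * 'Im (w - l)].
  move=> s2 t2 sr tr; pose mu := l + d * (s + 'i * t).
  have abs1 x : x ^+ 2 = 1 -> `|x| = 1 :> C.
    by move=> x2; apply/eqP; rewrite -(@eqrXn2 _ 2) // -normrX x2 normr1 expr1n.
  have mu1 : `|mu| < 1.
    apply: le_lt_trans (ler_normD _ _) _; rewrite normrM (ger0_norm (ltW d0)).
    apply: le_lt_trans (_ : `|l| + d * 2 < 1).
      rewrite lerD2l ler_wpM2l ?(ltW d0) //; apply: le_trans (ler_normD _ _) _.
      by rewrite normrM normCi mul1r !abs1.
    rewrite [ltRHS](_ : 1 = `|l| + d * 4); last first.
      by rewrite /d divfK ?pnatr_eq0 // addrC subrK.
    by rewrite ltrD2l ltr_pM2l // ltr_nat.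
  have [e eo el] := AWe mu mu1.
  move=> L; have [z [zz zL zD]] := persistent_limit eo el d0 L.
  exists z; split=> //; move: zD; set w := ip z (A z) => /= wD.
  have dr : d \is Num.real by rewrite ger0_real // ltW.
  have -> : w - l = (w - mu) + d * (s + 'i * t) by rewrite /mu; ring.
  move: (w - mu) wD => y yD; rewrite !raddfD /= ReMl // ImMl // Re_rect // Im_rect //.
  have key (u x : C) : u ^+ 2 = 1 -> u \is Num.real -> x \is Num.real -> `|x| < d -> 0 < u * (x + d * u).
    move=> u2 ur xr xd; rewrite mulrDr mulrCA -expr2 u2 mulr1 -subr_gt0 subr0.
    rewrite -[u * x]opprK addrC subr_gt0; apply: le_lt_trans xd.
    rewrite -[leRHS]mul1r -(abs1 u u2) -normrM -normrN.
    by rewrite real_ler_norm // rpredN rpredM.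
  split; apply: key => //; rewrite ?Creal_Re ?Creal_Im //.
    exact: le_lt_trans (normr_Re_le _) yD.
  exact: le_lt_trans (normr_Im_le _) yD.
have r1 : (1 : C) \is Num.real by [].
have rN1 : (-1 : C) \is Num.real by rewrite rpredN.
have e1 : (1 : C) ^+ 2 = 1 by rewrite expr1n.
have eN1 : (-1 : C) ^+ 2 = 1 by rewrite sqrrN expr1n.
have comb (t z1 z2 : C) : t * z1 + (1 - t) * z2 - l = t * (z1 - l) + (1 - t) * (z2 - l).
  by ring.
have half (t : C) : t ^+ 2 = 1 -> t \is Num.real ->
    persistent [set w | 'Re (w - l) = 0 /\ 0 < t * 'Im (w - l)].
  move=> t2 tr; apply: (persistent_segment (quadrant 1 t e1 t2 r1 tr) (quadrant (-1) t eN1 t2 rN1 tr)).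
  move=> z1 z2 [/= a1 b1] [/= a2 b2].
  rewrite mul1r in a1; rewrite mulN1r oppr_gt0 in a2.
  have [u /andP[u0 u1] uE] := convex_zero a1 a2.
  exists u; first by rewrite u0.
  have ur : u \is Num.real by rewrite ger0_real.
  have ur' : 1 - u \is Num.real by rewrite rpredB.
  rewrite /= comb; move: (z1 - l) (z2 - l) a1 b1 a2 b2 uE => y1 y2 a1 b1 a2 b2 uE.
  rewrite !raddfD /= !ReMl // !ImMl //; split=> //.
  rewrite mulrDr ![t * (_ * _)]mulrCA.
  have [->|uN0] := eqVneq u 0; first by rewrite mul0r add0r subr0 mul1r.
  have ugt0 : 0 < u by rewrite lt_def uN0.
  by apply: ltr_pwDl; [exact: mulr_gt0|rewrite mulr_ge0 ?subr_ge0 // ltW].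
apply: (persistent_segment (half 1 e1 r1) (half (-1) eN1 rN1)).
move=> z1 z2 [/= a1 b1] [/= a2 b2].
rewrite mul1r in b1; rewrite mulN1r oppr_gt0 in b2.
have [u /andP[u0 u1] uE] := convex_zero b1 b2.
exists u; first by rewrite u0.
have ur : u \is Num.real by rewrite ger0_real.
have ur' : 1 - u \is Num.real by rewrite rpredB.
apply/eqP; rewrite -subr_eq0; apply/eqP; rewrite comb [LHS]Crect.
move: (z1 - l) (z2 - l) a1 b1 a2 b2 uE => y1 y2 a1 b1 a2 b2 uE.
have -> : 'Re (u * y1 + (1 - u) * y2) = 0.
  by rewrite raddfD /= !ReMl // a1 a2 !mulr0 addr0.
have -> : 'Im (u * y1 + (1 - u) * y2) = 0 by rewrite raddfD /= !ImMl.
by rewrite mulr0 addr0.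
Qed.

End ComplexValues.

Arguments persistent {C V} dot A D.

(** * Shift blocks in the complex space *)

Section ComplexBlocks.
Context {C : numClosedFieldType} {V : completeNormedModType C}
  {dot : {dot V for @Num.conj C}}.
Hypotheses (Kok : conj_scalars (@Num.conj C)) (dotE : induces_norm dot).
Variables (A B : {linear V -> V}).
Local Notation ip := (inner dot).
Hypothesis AB : forall x y, ip (A x) y = ip x (B y).
Let ipP := ip_semi dotE.

(** The list extra z collects the further vectors to which the later terms have
    to be orthogonal, such as the conjugates of z. *)
Lemma diagonal_sequence (lam : nat -> C) (extra : V -> seq V) (Q : V -> Prop) (L0 : seq V) :
  (forall n (L : seq V), exists z, [/\ ip z z = 1, forall v, v \in L -> ip v z = 0,
     ip z (A z) = lam n & Q z]) ->
  exists e : nat -> V, [/\ forall i j, ip (e i) (e j) = (i == j)%:R,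
    forall i j, ip (e i) (A (e j)) = (i == j)%:R * lam j,
    forall i v, v \in L0 -> ip v (e i) = 0,
    forall i, Q (e i)
  & forall i j v, (i < j)%N -> v \in extra (e i) -> ip v (e j) = 0].
Proof.
move=> H; pose ext z := [:: z; A z; B z] ++ extra z.
have [e eP] := greedy_sequence ext L0 H.
have orth i j v : (i < j)%N -> v \in ext (e i) -> ip v (e j) = 0.
  by move=> ij vi; have [L [[_ h _ _] _ sub]] := eP j; apply: h; exact: (sub i ij).
exists e; split=> [i j|i j|i v vL|i|i j v ij vi].
- have [ij|ji|->] := ltngtP i j.
  + by apply: orth ij _; rewrite inE eqxx.
  + by rewrite -(formC ipP) (orth j i) ?rmorph0 // inE eqxx.
  + by have [L [[]]] := eP j.
- have [ij|ji|->] := ltngtP i j; rewrite ?mul0r.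
  + by rewrite -(ip_adjoint dotE AB); apply: orth ij _; rewrite !inE eqxx !orbT.
  + by rewrite -(formC ipP) (orth j i) ?rmorph0 // !inE eqxx orbT.
  + by rewrite mul1r; have [L [[]]] := eP j.
- by have [L [[_ h _ _] sub _]] := eP i; apply: h; exact: sub.
- by have [L [[]]] := eP i.
- by apply: orth ij _; rewrite mem_cat vi orbT.
Qed.

(** The discrete Fourier transform turns the diagonal compression with entries
    r w^k, w a primitive root of unity, into r times a cyclic shift of size
    N > m+1, which contains the nilpotent shift of size m+1. *)
Lemma fourier_blocks (m : nat) (r : C) : exists N (w : C) (c : nat -> 'I_N -> C),
  `|w| = 1 /\ forall e : nat -> V,
    (forall i j, ip (e i) (e j) = (i == j)%:R) ->
    (forall i j, ip (e i) (A (e j)) = (i == j)%:R * (r * w ^+ j)) ->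
    let f a := \sum_k c a k *: e k in
    forall a b : 'I_m.+1, ip (f a) (f b) = (a == b)%:R /\
      ip (f a) (A (f b)) = r * (b == a.+1 :> nat)%:R.
Proof.
have [N [w [mN wN]]] := primitive_root_large C m.+1.
have N0 : (0 < N)%N by apply: leq_ltn_trans mN.
have wNE := prim_expr_order wN.
have w1 : `|w| = 1.
  by apply/eqP; rewrite -(@eqrXn2 _ N) // -normrX wNE normr1 expr1n.
have w0 : w != 0 by rewrite -normr_eq0 w1 oner_eq0.
have cw : Num.conj w = w^-1.
  by apply: (mulIf w0); rewrite (conj_mul Kok) w1 expr1n mulVf.
have Ni0 : 0 <= (N%:R : C)^-1 by rewrite invr_ge0 ler0n.
have [s s0 s2] := root_exists Kok Ni0.
exists N, w, (fun a k => s * (w ^- a) ^+ k); split=> // e eo eA f a b.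
have cc a' k : Num.conj (s * (w ^- a') ^+ k) = s * (w ^+ a') ^+ k.
  rewrite rmorphM (conj_ge0 Kok s0) rmorphXn fmorphV rmorphXn /= cw.
  by rewrite exprVn invrK.
have NN : s ^+ 2 * N%:R = 1 by rewrite s2 mulVf // pnatr_eq0 -lt0n.
have geo (i j : nat) : (i < N)%N -> (j < N)%N ->
    s ^+ 2 * (\sum_(k < N) (w ^+ i / w ^+ j) ^+ k) = (i == j)%:R.
  move=> iN jN; have [->|ij] := eqVneq i j.
    under eq_bigr do rewrite divff ?expf_neq0 // expr1n.
    by rewrite sumr_const card_ord NN.
  rewrite geometric_sum0 ?mulr0 //.
    by rewrite expr_div_n -!exprM mulnC [(j * N)%N]mulnC !exprM wNE !expr1n divr1.
  apply: contra_neq ij => h.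
  have /eqP : w ^+ i = w ^+ j by rewrite -[RHS]mul1r -h divfK ?expf_neq0.
  by rewrite (eq_prim_root_expr wN) !modn_small // => /eqP.
have lt_ord (i : 'I_m.+1) : (i < N)%N by apply: leq_trans (ltn_ord i) (ltnW mN).
have comb (lm : nat -> C) (e' : nat -> V) :
    (forall i j, ip (e i) (e' j) = (i == j)%:R * lm j) ->
    ip (f a) (\sum_(k < N) (s * (w ^- b) ^+ k) *: e' k) =
    s ^+ 2 * \sum_(k < N) lm k * (w ^+ a / w ^+ b) ^+ k.
  move=> ee'; rewrite (ip_combination dotE (w := fun k : 'I_N => e k)
    (w' := fun k : 'I_N => e' k) _ _ (G := fun i j => (i == j :> nat)%:R * lm j)) //.
  rewrite mulr_sumr; apply: eq_bigr => i _.
  rewrite (bigD1 i) //= eqxx big1 ?addr0; first by rewrite cc exprMn [true%:R * _]mul1r; move: (_ ^+ i) (_ ^+ i) => x y; ring.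
  by move=> j ji; rewrite eq_sym val_eqE (negbTE ji) mul0r mulr0 mul0r.
split.
  rewrite (comb (fun=> 1) e); last by move=> i j; rewrite mulr1 eo.
  by under eq_bigr do rewrite mul1r; rewrite geo.
rewrite linear_sum; under [X in ip _ X]eq_bigr do rewrite linearZ /=.
rewrite (comb (fun k => r * w ^+ k) (fun k => A (e k))) //.
rewrite eq_sym -geo ?lt_ord //; last by apply: leq_ltn_trans (ltn_ord a) mN.
rewrite mulrCA; congr (_ * _); rewrite mulr_sumr; apply: eq_bigr => k _.
by rewrite -mulrA -exprMn mulrA -exprS.
Qed.

Lemma shift_blocks_of_values (m : nat) (r : C) : 0 <= r < 1 ->
  (forall l, `|l| < 1 -> persistent dot A [set l]) ->
  has_shift_blocks dot A r m idfun.
Proof.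
move=> /andP[r0 r1] val L; have [N [w [c [w1 cP]]]] := fourier_blocks m r.
have rw n : `|r * w ^+ n| < 1 by rewrite normrM normrX w1 expr1n mulr1 ger0_norm.
have [|e [eo eA eL _ _]] := @diagonal_sequence (fun n => r * w ^+ n) (fun=> [::])
    (fun=> True) L.
  by move=> n L'; have [z [h1 h2 h3]] := val _ (rw n) L'; exists z.
exists (fun a => \sum_k c a k *: e k); split=> // [v a vL|a b|a b].
- by rewrite (form_sumr ipP) big1 // => k _; rewrite (formZr ipP) eL ?mulr0.
- by have [] := cP e eo eA a b.
- by have [] := cP e eo eA a b.
Qed.

Section Conjugation.
Variable J : V -> V.
Hypotheses (Jlin : forall a x y, J (a *: x + y) = Num.conj a *: J x + J y)
  (JK : forall x, J (J x) = x) (Jip : forall x y, ip (J x) (J y) = ip y x)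
  (AJ : forall x, A (J x) = J (A x)).

Lemma conj_form_sym x y : ip (J x) y = ip (J y) x.
Proof. by rewrite -{1}[y]JK Jip. Qed.

Lemma conj0 : J 0 = 0.
Proof. by have := Jlin (-1) 0 0; rewrite scaler0 add0r rmorphN1 scaleN1r addNr. Qed.

Lemma conjD x y : J (x + y) = J x + J y.
Proof. by have := Jlin 1 x y; rewrite rmorph1 !scale1r. Qed.

Lemma conjZ a x : J (a *: x) = Num.conj a *: J x.
Proof. by have := Jlin a x 0; rewrite conj0 !addr0. Qed.

Lemma conj_sum (I : finType) (c : I -> C) (x : I -> V) :
  J (\sum_i c i *: x i) = \sum_i Num.conj (c i) *: J (x i).
Proof.
rewrite (big_morph J conjD conj0); apply: eq_bigr => i _.
exact: conjZ.
Qed.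

Lemma conj_form_sum (I : finType) (c d : I -> C) (x y : I -> V) :
  ip (J (\sum_i c i *: x i)) (\sum_i d i *: y i) =
  \sum_i \sum_j c i * ip (J (x i)) (y j) * d j.
Proof.
rewrite conj_sum (ip_combination dotE _ _ (G := fun i j => ip (J (x i)) (y j))) //.
by apply: eq_bigr => i _; apply: eq_bigr => j _; congr (_ * _ * _); exact: conjCK.
Qed.

(** A value taken persistently is also taken at isotropic vectors of the two
    symmetric forms <Jx,y> and <Jx,Ay>: these are two equations, so among any
    three vectors some combination solves them, and the square roots of its
    coefficients do the job because the cross terms vanish. *)
Lemma isotropic_value (l : C) (L : seq V) : persistent dot A [set l] ->
  exists z, [/\ ip z z = 1, forall v, v \in L -> ip v z = 0, ip z (A z) = l
    & ip (J z) z = 0 /\ ip (J z) (A z) = 0].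
Proof.
move=> val; have [|e [eo eA eL _ eJ]] := @diagonal_sequence (fun=> l)
    (fun z => [:: J z; A (J z); B (J z)]) (fun=> True) L.
  by move=> _ L'; have [z [h1 h2 h3]] := val L'; exists z.
have J0 i j : i != j -> ip (J (e i)) (e j) = 0.
  rewrite neq_ltn => /orP[ij|ji].
    by apply: (eJ i j) => //; rewrite inE eqxx.
  by rewrite conj_form_sym; apply: (eJ j i) => //; rewrite inE eqxx.
have JA0 i j : i != j -> ip (J (e i)) (A (e j)) = 0.
  rewrite neq_ltn => /orP[ij|ji].
    by rewrite -(ip_adjoint dotE AB); apply: (eJ i j) => //; rewrite !inE eqxx !orbT.
  by rewrite conj_form_sym -AJ; apply: (eJ j i) => //; rewrite !inE eqxx orbT.
have [c [c1 cE]] := unit_combination (fun s (b : bool) =>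
  if b then ip (J (e s)) (e s) else ip (J (e s)) (A (e s))) Kok.
pose N := #|{: bool}|.+1; pose q := \sum_s `|c s|.
have q0 : 0 < q.
  rewrite lt_def sumr_ge0 // andbT; apply/eqP => /eqP.
  rewrite psumr_eq0 // => /allP h; have := oner_neq0 C.
  rewrite -c1 big1 ?eqxx // => s _.
  by have := h s (mem_index_enum _); rewrite normr_eq0 => /eqP ->; rewrite mulr0.
pose d s := sqrtC (c s / q).
have d2 s : d s * d s = c s / q by rewrite -expr2 sqrtCK.
have dd s : Num.conj (d s) * d s = `|c s| / q.
  by rewrite (conj_mul Kok) -normrX sqrtCK normrM normfV (ger0_norm (ltW q0)).
have isot (G : nat -> nat -> C) : (forall i j, i != j -> G i j = 0) ->
    \sum_(s < N) c s * G s s = 0 -> \sum_(s < N) \sum_(t < N) d s * G s t * d t = 0.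
  move=> G0 Gc; transitivity (q^-1 * \sum_(s < N) c s * G s s); last by rewrite Gc mulr0.
  rewrite mulr_sumr; apply: eq_bigr => s _; rewrite (bigD1 s) //= big1 ?addr0.
    by rewrite mulrAC d2; ring.
  by move=> t ts; rewrite G0 ?mulr0 ?mul0r // eq_sym.
have norm1 : \sum_s Num.conj (d s) * d s = 1.
  by under eq_bigr do rewrite dd; rewrite -mulr_suml divff // gt_eqF.
exists (\sum_s d s *: e s); split.
- rewrite (ip_combination dotE _ _ (G := fun s t => (s == t)%:R)).
    by rewrite (sum_delta (theta := @Num.conj C)).
  by move=> s t; rewrite eo.
- by move=> v vL; rewrite (form_sumr ipP) big1 // => s _; rewrite (formZr ipP) eL ?mulr0.
- rewrite linear_sum; under [X in ip _ X]eq_bigr do rewrite linearZ /=.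
  rewrite (ip_combination dotE _ _ (G := fun s t => l * (s == t)%:R)); last first.
    by move=> s t; rewrite eA mulrC.
  rewrite -[RHS]mulr1 -[in RHS]norm1 -(sum_delta (theta := @Num.conj C)) mulr_sumr.
  by apply: eq_bigr => s _; rewrite mulr_sumr; apply: eq_bigr => t _; ring.
- split.
    by rewrite conj_form_sum; apply: (isot (fun s t => ip (J (e s)) (e t))) => //; exact: (cE true).
  rewrite linear_sum; under [X in ip _ X]eq_bigr do rewrite linearZ /=.
  rewrite conj_form_sum; apply: (isot (fun s t => ip (J (e s)) (A (e t)))) => //.
  exact: (cE false).
Qed.

(** For f orthogonal and A-orthogonal to every J f', the real vectors
    (f + J f)/2^(1/2) have the same Gram matrix and the same compression, both
    of which have real entries here. *)
Lemma real_shift_blocks (m : nat) (r : C) (L : seq V) : 0 <= r < 1 ->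
  (forall l, `|l| < 1 -> persistent dot A [set l]) ->
  exists g : 'I_m.+1 -> V,
    [/\ forall a, J (g a) = g a,
        forall v a, v \in L -> J v = v -> ip v (g a) = 0,
        forall a b, ip (g a) (g b) = (a == b)%:R
      & forall a b, ip (g a) (A (g b)) = r * (b == a.+1 :> nat)%:R].
Proof.
move=> /andP[r0 r1] val; have [N [w [c [w1 cP]]]] := fourier_blocks m r.
have rw n : `|r * w ^+ n| < 1 by rewrite normrM normrX w1 expr1n mulr1 ger0_norm.
have [|e [eo eA eL eQ eJ]] := @diagonal_sequence (fun n => r * w ^+ n)
    (fun z => [:: J z; A (J z); B (J z)])
    (fun z => ip (J z) z = 0 /\ ip (J z) (A z) = 0) L.
  by move=> n L'; exact: isotropic_value (val _ (rw n)).
have J0 i j : ip (J (e i)) (e j) = 0.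
  have [ij|ji|->] := ltngtP i j; last by case: (eQ j).
    by apply: (eJ i j) => //; rewrite inE eqxx.
  by rewrite conj_form_sym; apply: (eJ j i) => //; rewrite inE eqxx.
have JA0 i j : ip (J (e i)) (A (e j)) = 0.
  have [ij|ji|->] := ltngtP i j; last by case: (eQ j).
    by rewrite -(ip_adjoint dotE AB); apply: (eJ i j) => //; rewrite !inE eqxx !orbT.
  by rewrite conj_form_sym -AJ; apply: (eJ j i) => //; rewrite !inE eqxx orbT.
pose f (a : 'I_m.+1) := \sum_k c a k *: e k.
have fo a b : ip (f a) (f b) = (a == b)%:R by have [] := cP e eo eA a b.
have fA a b : ip (f a) (A (f b)) = r * (b == a.+1 :> nat)%:R by have [] := cP e eo eA a b.
have Jf a b : ip (J (f a)) (f b) = 0.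
  by rewrite conj_form_sum big1 // => i _; rewrite big1 // => j _; rewrite J0 mulr0 mul0r.
have JAf a b : ip (J (f a)) (A (f b)) = 0.
  rewrite /f linear_sum; under [X in ip _ X]eq_bigr do rewrite linearZ /=.
  by rewrite conj_form_sum big1 // => i _; rewrite big1 // => j _; rewrite JA0 mulr0 mul0r.
have fJ a b : ip (f a) (J (f b)) = 0 by rewrite -(formC ipP) Jf rmorph0.
have fAJ a b : ip (f a) (A (J (f b))) = 0.
  by rewrite AJ -(formC ipP) conj_form_sym JAf rmorph0.
have JAJ a b : ip (J (f a)) (A (J (f b))) = r * (b == a.+1 :> nat)%:R.
  by rewrite AJ Jip -(formC ipP) fA rmorphM rmorph_nat (conj_ge0 Kok r0).
have JJ a b : ip (J (f a)) (J (f b)) = (a == b)%:R by rewrite Jip fo eq_sym.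
have h0 : 0 <= (2 : C)^-1 by rewrite invr_ge0 ler0n.
have [s s0 s2] := root_exists Kok h0.
have cs := conj_ge0 Kok s0.
have half (x : C) : s * (s * (x + x)) = x.
  by rewrite mulrA -expr2 s2; field.
exists (fun a => s *: (f a + J (f a))); split=> [a|v a vL Jv|a b|a b].
- by rewrite conjZ conjD JK addrC cs.
- have fv : ip v (f a) = 0.
    by rewrite (form_sumr ipP) big1 // => k _; rewrite (formZr ipP) eL ?mulr0.
  by rewrite (formZr ipP) (formDr ipP) fv -{1}Jv Jip -(formC ipP) fv rmorph0 addr0 mulr0.
- rewrite (formZl ipP) (formZr ipP) (formDl ipP) !(formDr ipP) fo fJ Jf JJ cs.
  by rewrite add0r addr0 half.
- rewrite [A _]linearZ [A (_ + _)]linearD /= (formZl ipP) (formZr ipP) (formDl ipP) !(formDr ipP).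
  by rewrite fA fAJ JAf JAJ cs add0r addr0 half.
Qed.

End Conjugation.
End ComplexBlocks.

(** * Real and complex scalars *)

Section Scalars.
Variable R : realType.

Lemma real_decreasing_cauchy (u : nat -> R) : (forall n, 0 <= u n.+1 <= u n) ->
  forall e, 0 < e -> exists n, forall m, (n <= m)%N -> u n - u m < e.
Proof.
move=> uP e e0; pose v n := u n.+1.
have vdec : {homo v : n m / (n <= m)%N >-> m <= n}.
  by apply/nonincreasing_seqP => n; case/andP: (uP n.+1).
have vc : cvgn v.
  apply: nonincreasing_is_cvgn => //; exists 0 => _ [n _ <-].
  by case/andP: (uP n).
have vge := nonincreasing_cvgn_ge vdec vc.
move/cvgrPdist_lt/(_ _ e0): (vc) => [n _ nP].
exists n.+1 => m nm; have -> : m = m.-1.+1 by rewrite prednK // (leq_trans _ nm).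
apply: le_lt_trans (nP n (leqnn n)).
rewrite distrC ger0_norm ?subr_ge0 // lerD2l lerN2.
exact: vge.
Qed.

Lemma real_conj_scalars : conj_scalars (@idfun R).
Proof.
split=> /= [a|a a0|].
- by rewrite real_normK ?num_real // expr2.
- by exists (Num.sqrt a); rewrite ?sqrtr_ge0 ?sqr_sqrtr.
- exact: real_decreasing_cauchy.
Qed.

Lemma complex_conj_scalars : conj_scalars (@Num.conj R[i]).
Proof.
split=> [a|a a0|u uP e e0].
- by rewrite mulrC normCK.
- by exists (sqrtC a); rewrite ?sqrtC_ge0 ?sqrtCK.
have geRe (x : R[i]) : 0 <= x -> x = (complex.Re x)%:C.
  by rewrite lecE /= => /andP[/eqP h _]; rewrite {1}[x]complexE h mulr0 addr0.
have uRe n : u n = (complex.Re (u n))%:C.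
  apply: geRe; case/andP: (uP n) => h1 h2; exact: le_trans h2.
have eRe := geRe e (ltW e0).
have [||n nP] := real_decreasing_cauchy (u := fun n => complex.Re (u n)) _ (e := complex.Re e).
- by move=> n; rewrite -!lecR -!uRe.
- by rewrite -ltcR -eRe.
exists n => m nm; rewrite uRe (uRe m) eRe -rmorphB /= ltcR.
exact: nP.
Qed.

Lemma shift_parameters (rho : R) : 0 <= rho < 1 ->
  exists r m, 0 <= r < 1 /\ rho < r * m%:R / m.+1%:R.
Proof.
move=> /andP[rho0 rho1]; pose r := (1 + rho) / 2.
have r0 : 0 < r by rewrite divr_gt0 // ltr_pwDl.
have r1 : r < 1 by rewrite ltr_pdivrMr // mul1r [2](_ : _ = 1 + 1) ?ltrD2l.
have rr : rho < r by rewrite ltr_pdivlMr // mulr_natr mulr2n ltrD2r.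
have : rho / r < 1 by rewrite ltr_pdivrMr // mul1r.
case/ltr_add_invr => m hm; exists r, m; rewrite (ltW r0) r1; split=> //.
rewrite -mulrA -ltr_pdivrMl // mulrC -ltrBrDr in hm *.
apply: lt_le_trans hm _; rewrite le_eqVlt; apply/orP; left; apply/eqP.
by rewrite -natr1; field; rewrite natr1 pnatr_eq0.
Qed.

Lemma operator_bound (H : completeNormedModType R[i]) (A_ : nat -> {linear H -> H}) :
  (ereal_sup (range (fun n => opnorm (A_ n))) < 1%:E)%E ->
  exists2 rho : R, 0 <= rho < 1 & forall n x, `|A_ n x| <= rho%:C * `|x|.
Proof.
set s := ereal_sup _ => s1.
have opn n (x : H) : `|x| <= 1 -> ((complex.Re `|A_ n x|)%:E <= s)%E.
  move=> x1; apply: (@le_trans _ _ (opnorm (A_ n))).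
    by apply: ereal_sup_ubound; exists x.
  by apply: ereal_sup_ubound; exists n.
have s0 : (0%:E <= s)%E.
  have := opn 0%N 0; rewrite linear0 !normr0; apply; exact: ler01.
have sfin : s \is a fin_num.
  by rewrite ge0_fin_numE //; apply: lt_trans s1 _; rewrite ltry.
exists (fine s).
  by rewrite -!lee_fin -lte_fin fineK // s0.
move=> n x; have [->|x0] := eqVneq x 0; first by rewrite linear0 !normr0 mulr0.
have nx : 0 < `|x| by rewrite normr_gt0.
have := opn n (`|x|^-1 *: x).
rewrite linearZ /= !normrZ ger0_norm ?invr_ge0 // mulVf ?gt_eqF // => /(_ (lexx _)).
rewrite -[X in (_ <= X)%E -> _]fineK // lee_fin -lecR.
have -> : (complex.Re (`|x|^-1 * `|A_ n x|))%:C = `|x|^-1 * `|A_ n x|.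
  have : 0 <= `|x|^-1 * `|A_ n x| by rewrite mulr_ge0 ?invr_ge0.
  by rewrite lecE /= => /andP[/eqP h _]; rewrite [RHS]complexE h mulr0 addr0.
by rewrite ler_pdivrMl // mulrC.
Qed.

End Scalars.

(** * Complexifications *)

Section Complexify.
Context {R : realType} {H : completeNormedModType R[i]} {HR : completeNormedModType R}
  {dot : {dot H for @Num.conj R[i]}} {dotR : {dot HR for idfun}} {iota : HR -> H}.
Hypotheses (dotE : induces_norm dot) (dotRE : induces_norm dotR)
  (iotaP : is_complexification dot dotR iota).
Local Notation ip := (inner dot).
Local Notation ipR := (inner dotR).
Local Notation cpair x y := (iota x + 'i *: iota y).
Let Cok := complex_conj_scalars R.
Let Rok := real_conj_scalars R.
Let ipP := ip_semi dotE.
Let ipRP := ip_semi dotRE.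

Lemma iotaL a x y : iota (a *: x + y) = a%:C *: iota x + iota y.
Proof. by case: iotaP. Qed.

Lemma iota_ip x y : ip (iota x) (iota y) = (ipR x y)%:C.
Proof. by case: iotaP. Qed.

Lemma pair_surj h : exists x y, h = cpair x y.
Proof. by case: iotaP. Qed.

Lemma iotaD x y : iota (x + y) = iota x + iota y.
Proof. by have := iotaL 1 x y; rewrite !scale1r. Qed.

Lemma iota0 : iota 0 = 0.
Proof. by apply: (addrI (iota 0)); rewrite -iotaD !addr0. Qed.

Lemma iotaZ a x : iota (a *: x) = a%:C *: iota x.
Proof. by have := iotaL a x 0; rewrite iota0 !addr0. Qed.

Lemma iotaB x y : iota (x - y) = iota x - iota y.
Proof. by rewrite iotaD -scaleN1r iotaZ rmorphN1 scaleN1r. Qed.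

Lemma pair0 x : cpair x 0 = iota x.
Proof. by rewrite iota0 scaler0 addr0. Qed.

Lemma pairD x y x' y' : cpair x y + cpair x' y' = cpair (x + x') (y + y').
Proof. by rewrite !iotaD scalerDr addrACA. Qed.

Lemma pairB x y x' y' : cpair x y - cpair x' y' = cpair (x - x') (y - y').
Proof. by rewrite !iotaB scalerBr opprD addrACA. Qed.

Lemma pairZ (c : R[i]) x y : c *: cpair x y =
  cpair (complex.Re c *: x - complex.Im c *: y) (complex.Re c *: y + complex.Im c *: x).
Proof.
set a := complex.Re c; set b := complex.Im c.
have ii : 'i * 'i = -1 :> R[i] by rewrite -expr2 sqr_i.
rewrite [c]complexE -/a -/b iotaB iotaD !iotaZ.
rewrite scalerDl ![_ *: (iota x + _)]scalerDr !scalerA [a%:C * 'i]mulrC.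
rewrite (_ : 'i * b%:C * 'i = - b%:C); last by rewrite mulrAC ii mulN1r.
rewrite scaleNr scalerDr !scalerA addrACA [X in _ = _ + X]addrC [RHS]addrACA.
by congr (_ + _); exact: addrC.
Qed.

Lemma ip_pair x y x' y' : ip (cpair x y) (cpair x' y') =
  (ipR x x' + ipR y y')%:C + 'i * (ipR x y' - ipR y x')%:C.
Proof.
have ci : Num.conj ('i : R[i]) = - 'i.
  by apply/eqP; rewrite eq_complex /= oppr0 !eqxx.
have ii : 'i * 'i = -1 :> R[i] by rewrite -expr2 sqr_i.
rewrite (formDl ipP) !(formDr ipP) !(formZl ipP) !(formZr ipP) !iota_ip.
rewrite (ci : (@Num.conj R[i] : {rmorphism R[i] -> R[i]}) 'i = - 'i) rmorphD rmorphB /=.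
have -> : - 'i * ('i * (ipR y y')%:C) = (ipR y y')%:C by rewrite mulrA mulNr ii opprK mul1r.
ring.
Qed.

Lemma norm_pair x y : `|cpair x y| ^+ 2 = (`|x| ^+ 2 + `|y| ^+ 2)%:C.
Proof.
rewrite -(ipE dotE) ip_pair !(ipE dotRE) -(formC ipRP x y) /= subrr.
by rewrite mulr0 addr0.
Qed.

Lemma norm_iota x : `|iota x| = `|x|%:C.
Proof.
apply/eqP; rewrite -(@eqrXn2 _ 2) ?lecR // -rmorphXn /= -pair0 norm_pair.
by rewrite normr0 expr0n addr0.
Qed.

Lemma pair_inj x y x' y' : cpair x y = cpair x' y' -> x = x' /\ y = y'.
Proof.
move=> e; have : `|cpair x y - cpair x' y'| ^+ 2 = 0 by rewrite e subrr normr0 expr0n.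
rewrite pairB norm_pair => /eqP; rewrite -[0]/(0%:C) (inj_eq (@complexI _)).
rewrite paddr_eq0 ?exprn_ge0 // !sqrf_eq0 !normr_eq0 !subr_eq0.
by case/andP => /eqP -> /eqP ->.
Qed.

Lemma norm_fst_le x y : `|x|%:C <= `|cpair x y|.
Proof.
rewrite -(ler_pXn2r (n := 2)) ?nnegrE ?lecR // norm_pair -rmorphXn lecR.
by rewrite lerDl exprn_ge0.
Qed.

Lemma complex_parts : exists re im : H -> HR,
  (forall h, h = cpair (re h) (im h)) /\
  forall x y, re (cpair x y) = x /\ im (cpair x y) = y.
Proof.
have /choice [p pP] : forall h, exists p : HR * HR, h = cpair p.1 p.2.
  by move=> h; have [x [y ->]] := pair_surj h; exists (x, y).
exists (fun h => (p h).1), (fun h => (p h).2); split=> // x y.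
by have /esym/pair_inj := pP (cpair x y).
Qed.

Lemma complexify_exists (T : {linear HR -> HR}) :
  exists T' : {linear H -> H}, complexifies iota T T'.
Proof.
have [re [im [reim parts]]] := complex_parts.
have [|T' T'E] := @linear_map_exists _ H H (fun h => cpair (T (re h)) (T (im h))).
  move=> c h k; have -> : c *: h + k =
      cpair (complex.Re c *: re h - complex.Im c *: im h + re k)
        (complex.Re c *: im h + complex.Im c *: re h + im k).
    by rewrite {1}(reim h) {1}(reim k) pairZ pairD.
  set x := _ + re k; set y := _ + im k; have [-> ->] := parts x y.
  by rewrite pairZ pairD /x /y !linearD linearN !linearZ.
by exists T' => x y; rewrite T'E; have [-> ->] := parts x y.
Qed.

Lemma conjugation_exists : exists J : H -> H,
  [/\ forall x y, J (cpair x y) = cpair x (- y),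
      forall a h k, J (a *: h + k) = Num.conj a *: J h + J k,
      forall h, J (J h) = h
    & forall h k, ip (J h) (J k) = ip k h].
Proof.
have [re [im [reim parts]]] := complex_parts.
pose J h := cpair (re h) (- im h).
have JE x y : J (cpair x y) = cpair x (- y) by rewrite /J; have [-> ->] := parts x y.
exists J; split=> // [a h k|h|h k].
- have [x [y ->]] := pair_surj h; have [x' [y' ->]] := pair_surj k.
  rewrite pairZ pairD !JE pairZ pairD.
  have -> : complex.Re (Num.conj a) = complex.Re a by case: a.
  have -> : complex.Im (Num.conj a) = - complex.Im a by case: a.
  by rewrite !opprD !scalerN !scaleNr opprK.
- by have [x [y ->]] := pair_surj h; rewrite !JE opprK.
- have [x [y ->]] := pair_surj h; have [x' [y' ->]] := pair_surj k.
  rewrite !JE !ip_pair !(formNr ipRP) !(formNl ipRP) opprK.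
  rewrite -(formC ipRP x x') -(formC ipRP y y') -(formC ipRP x y') -(formC ipRP y x') /=.
  by rewrite opprK [- _ + _]addrC.
Qed.

(** The real part is a contraction, so it maps a dense set onto a dense set. *)
Lemma real_form_separable : separable_space H -> separable_space HR.
Proof.
move=> [D Dc Dd]; have [re [im [reim parts]]] := complex_parts.
exists (re @` D); first exact: card_le_trans (card_image_le re D) Dc.
move=> O [x Ox] Oo; have /nbhs_ballP [e /= e0 xe] : nbhs x O by exact: open_nbhs_nbhs.
have eC : 0 < e%:C by rewrite ltcR.
have [h [/= hx Dh]] := Dd (ball (iota x) e%:C) (ex_intro _ _ (ballxx _ eC)) (ball_open _ _).
exists (re h); split; last by exists h.
apply: xe; rewrite -ball_normE /= -ltcR.
move: hx; rewrite -ball_normE /=; apply: le_lt_trans.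
have -> : iota x - h = cpair (x - re h) (0 - im h) by rewrite -pairB -reim pair0.
exact: norm_fst_le.
Qed.

Section Operators.
Context {A : {linear H -> H}} {AR : {linear HR -> HR}}.
Hypothesis AE : complexifies iota AR A.

Lemma complexifies_iota x : A (iota x) = iota (AR x).
Proof. by rewrite -[iota x]pair0 AE linear0 pair0. Qed.

Lemma real_bound (rho : R) :
  (forall h, `|A h| <= rho%:C * `|h|) -> forall x, `|AR x| <= rho * `|x|.
Proof.
move=> Ab x; have := Ab (iota x).
by rewrite complexifies_iota !norm_iota -rmorphM lecR.
Qed.

(** A vector fixed by the conjugation lies in the image of iota. *)
Lemma real_form_shift_blocks (r : R) m :
  bounded_operator A -> separable_space H -> 0 <= r < 1 ->
  (forall l, `|l| < 1 -> persistent dot A [set l]) ->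
  has_shift_blocks dotR AR r m idfun.
Proof.
move=> /bounded_operatorP [CA CA0 ACA] Hsep /andP[r0 r1] val L.
have [B AB] := adjoint_exists Cok dotE Hsep CA0 ACA.
have [J [JE Jlin JK Jip]] := conjugation_exists.
have AJ h : A (J h) = J (A h).
  by have [x [y ->]] := pair_surj h; rewrite JE !AE JE linearN.
have rC : 0 <= r%:C < 1 by rewrite -[0]/(0%:C) -[1]/(1%:C) lecR ltcR r0.
have [g [Jg gL go gA]] := real_shift_blocks Cok dotE AB Jlin JK Jip AJ m (map iota L) rC val.
have /choice [y yP] : forall a, exists y, g a = iota y.
  move=> a; have [x [y ga]] := pair_surj (g a); exists x.
  have := Jg a; rewrite ga JE => /pair_inj [_ /eqP]; rewrite eq_sym -addr_eq0.
  rewrite -mulr2n -scaler_nat scaler_eq0 pnatr_eq0 /= => /eqP ->.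
  by rewrite pair0.
exists y; split=> // [v a vL|a b|a b].
- apply: (@complexI R); rewrite -iota_ip -yP; apply: gL; first exact: map_f.
  by rewrite -pair0 JE oppr0.
- by apply: (@complexI R); rewrite -iota_ip -!yP go rmorph_nat.
- by apply: (@complexI R); rewrite -iota_ip -complexifies_iota -!yP gA rmorphM rmorph_nat.
Qed.

End Operators.

Lemma complexify_projection (E : {linear H -> H}) (ER : {linear HR -> HR}) :
  complexifies iota ER E -> is_projection dotR ER -> is_projection dot E.
Proof.
move=> EE [ERb ERi ERs]; split.
- have [C C0 EC] := (bounded_operatorP ER).1 ERb.
  apply/bounded_operatorP; exists C%:C; first by rewrite lecR.
  move=> h; have [x [y ->]] := pair_surj h; rewrite EE.
  rewrite -(ler_pXn2r (n := 2)) ?nnegrE ?mulr_ge0 ?lecR //.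
  rewrite exprMn !norm_pair -rmorphXn -rmorphM lecR mulrDr -!exprMn.
  by rewrite lerD // lerXn2r ?nnegrE ?mulr_ge0.
- by move=> h; have [x [y ->]] := pair_surj h; rewrite !EE !ERi.
- move=> h k; have [x [y ->]] := pair_surj h; have [x' [y' ->]] := pair_surj k.
  by rewrite !EE !ip_pair !ERs.
Qed.

Lemma complexify_total (E : nat -> {linear H -> H}) (ER : nat -> {linear HR -> HR}) :
  (forall n, complexifies iota (ER n) (E n)) ->
  total_projections dotR ER -> total_projections dot E.
Proof.
move=> EE [Ep E0 Eo Et]; split.
- by move=> n; exact: complexify_projection (EE n) (Ep n).
- move=> n; have [x xN0] := E0 n; exists (iota x).
  rewrite (complexifies_iota (EE n)) -normr_eq0 norm_iota -[0]/(0%:C).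
  by rewrite (inj_eq (@complexI _)) normr_eq0.
- move=> m n mn h; have [x [y ->]] := pair_surj h.
  by rewrite !EE !Eo // pair0 iota0.
- move=> h; have [x [y ->]] := pair_surj h.
  have sum n : series (fun k => E k (cpair x y)) n =
      cpair (series (fun k => ER k x) n) (series (fun k => ER k y) n).
    rewrite /series /=; elim: n => [|n IH]; first by rewrite !big_geq // pair0 iota0.
    by rewrite !big_nat_recr //= IH EE pairD.
  apply: cvg_of_sqr_norm.
  under eq_fun do rewrite sum pairB norm_pair.
  apply/cvgrPdist_lt => e e0.
  have eE : e = (complex.Re e)%:C.
    by move: (ltW e0); rewrite lecE /= => /andP[/eqP h' _]; rewrite {1}[e]complexE h' mulr0 addr0.
  have e0' : 0 < complex.Re e by rewrite -ltcR -eE.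
  have lim : (fun n => `|series (fun k => ER k x) n - x| ^+ 2 +
      `|series (fun k => ER k y) n - y| ^+ 2) @ \oo --> (0 : R).
    have sq z : (fun n => `|series (fun k => ER k z) n - z| ^+ 2) @ \oo --> (0 : R).
      have n0 : (fun n => `|series (fun k => ER k z) n - z|) @ \oo --> (0 : R).
        rewrite -(normr0 HR) -(subrr z); apply: cvg_norm.
        by apply: cvgB; [exact: Et|exact: cvg_cst].
      rewrite -[0 : R](mulr0 0); apply: (@cvg_ext _ (fun n =>
        `|series (fun k => ER k z) n - z| * `|series (fun k => ER k z) n - z|)).
        by move=> n; rewrite expr2.
      by apply: cvgM.
    by rewrite -[0 : R](addr0 0); apply: cvgD.
  move/cvgrPdist_lt/(_ _ e0'): lim; apply: filterS => n.
  rewrite !sub0r !normrN eE => h'.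
  rewrite ger0_norm ?lecR ?addr_ge0 ?exprn_ge0 // ltcR.
  by move: h'; rewrite ger0_norm ?addr_ge0 ?exprn_ge0.
Qed.

Lemma complexify_unitarily_equivalent (A E X : {linear H -> H})
    (AR ER XR : {linear HR -> HR}) :
  complexifies iota AR A -> complexifies iota ER E -> complexifies iota XR X ->
  compression_unitarily_equivalent dotR AR ER XR ->
  compression_unitarily_equivalent dot A E X.
Proof.
move=> AE EE XE [UR [Uiso Ur Uc]]; have [U UE] := complexify_exists UR.
exists U; split.
- move=> h k; have [x [y ->]] := pair_surj h; have [x' [y' ->]] := pair_surj k.
  by rewrite !UE !ip_pair !Uiso.
- have RE x : exists z, UR x = ER z.
    have : range ER (UR x) by rewrite -Ur; exists x.
    by case=> z _ <-; exists z.
  have ER' x : exists z, ER x = UR z.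
    have : range UR (ER x) by rewrite Ur; exists x.
    by case=> z _ <-; exists z.
  apply/seteqP; split=> _ [h _ <-]; have [x [y ->]] := pair_surj h.
    have [x' xx'] := RE x; have [y' yy'] := RE y.
    by exists (cpair x' y') => //; rewrite EE UE xx' yy'.
  have [x' xx'] := ER' x; have [y' yy'] := ER' y.
  by exists (cpair x' y') => //; rewrite EE UE xx' yy'.
- move=> h; have [x [y ->]] := pair_surj h.
  rewrite /compression XE !UE EE AE EE.
  by have := Uc x; have := Uc y; rewrite /compression => -> ->.
Qed.

End Complexify.

(** * Pinchings *)

Theorem theorem1 (R : realType) (H : completeNormedModType R[i])
    (dot : {dot H for @Num.conj R[i]}) (dotE : induces_norm dot)
    (Hsep : separable_space H) (Hinf : infinite_dimensional H)
    (A : {linear H -> H}) (Abnd : bounded_operator A)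
    (AWe : [set z : R[i] | `|z| < 1] `<=` ess_num_range dot A)
    (A_ : nat -> {linear H -> H}) (A_bnd : forall n, bounded_operator (A_ n))
    (A_lt1 : (ereal_sup (range (fun n => opnorm (A_ n))) < 1%:E)%E) :
  (exists E : nat -> {linear H -> H},
     total_projections dot E /\
     forall n, compression_unitarily_equivalent dot A (E n) (A_ n)) /\
  (forall (HR : completeNormedModType R) (dotR : {dot HR for idfun})
      (iota : HR -> H),
    induces_norm dotR -> is_complexification dot dotR iota ->
    real_operator iota A -> (forall n, real_operator iota (A_ n)) ->
    exists E : nat -> {linear H -> H},
      [/\ total_projections dot E,
          forall n, compression_unitarily_equivalent dot A (E n) (A_ n)
        & forall n, real_projection dotR iota (E n)]).
Proof.
have Cok := complex_conj_scalars R.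
have [rho rho01 rhoA] := operator_bound A_lt1; have /andP[rho0 _] := rho01.
have [r [m [r01 rm]]] := shift_parameters rho01; have /andP[r0 r1] := r01.
have [CA CA0 ACA] := (bounded_operatorP A).1 Abnd.
have [B AB] := adjoint_exists Cok dotE Hsep CA0 ACA.
have val l : `|l| < 1 -> persistent dot A [set l] by exact: (persistent_value Cok dotE AB AWe).
split.
  have rC : 0 <= r%:C < 1 by rewrite -[0]/(0%:C) -[1]/(1%:C) lecR ltcR r0.
  apply: (pinching_of_shift_blocks (m := m) (r := r%:C) (rho := rho%:C) Cok dotE Hsep Abnd) => //.
  - exact: (shift_blocks_of_values Cok dotE AB m rC val).
  - by rewrite lecR.
  - by rewrite -!(rmorph_nat (real_complex R)) -rmorphM -fmorph_div ltcR.
move=> HR dotR iota dotRE iotaP [AR ARb AE] A_real.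
have /choice [XR XE] : forall n, exists XR, complexifies iota XR (A_ n).
  by move=> n; have [XR _ XE] := A_real n; exists XR.
have HRsep := real_form_separable dotE dotRE iotaP Hsep.
have ARsh := real_form_shift_blocks dotE dotRE iotaP AE m Abnd Hsep r01 val.
have XRb n x : `|XR n x| <= rho * `|x|.
  exact: (real_bound dotE dotRE iotaP (XE n) (rhoA n)).
have [ER [ERt ERc]] := pinching_of_shift_blocks (real_conj_scalars R) dotRE
  HRsep ARb ARsh XRb rho0 rm.
have /choice [E EE] : forall n, exists E, complexifies iota (ER n) E.
  by move=> n; exact: (complexify_exists dotE dotRE iotaP).
exists E; split=> [|n|n].
- exact: (complexify_total dotE dotRE iotaP EE ERt).
- exact: (complexify_unitarily_equivalent dotE dotRE iotaP AE (EE n) (XE n) (ERc n)).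
- by exists (ER n) => //; case: ERt.
Qed.
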